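(* Let $u\in[0,1]$, let $\sigma\in S_r$ be a fixed permutation, and let $\lambda\vdash n$ be distributed according to the Plancherel measure of size $n$. Put $m_\sigma:=\mathbb{E}^r_{PL}[TS^\nu(\sigma)]$, where $\nu\vdash r$. Then, as $n\to\infty$, $$PS^\lambda_u(\sigma)\ \xrightarrow{p}\ u\cdot m_\sigma$$ in probability.
   Context: Partitions $\lambda\vdash n$ are identified with Young diagrams in English notation (row 1 on top); the box in row $b$ and column $a$ has content $a-b$. $\mathrm{SYT}(\lambda)$ is the set of standard Young tableaux of shape $\lambda$ and $\dim\lambda=|\mathrm{SYT}(\lambda)|$. For $T\in\mathrm{SYT}(\lambda)$ let $c_k(T)$ be the content of the box containing $k$, and $d_k(T):=c_{k+1}(T)-c_k(T)$. If $k,k+1$ lie in different rows and different columns of $T$, $(k,k+1)T$ is the standard tableau obtained by exchanging them. The representation $\pi^\lambda$ of $S_n$ has matrices with rows and columns indexed by $\mathrm{SYT}(\lambda)$, determined by: $\pi^\lambda((k,k+1))_{T,S}=1/d_k(T)$ if $S=T$; $=\sqrt{1-1/d_k(T)^2}$ if $S=(k,k+1)T$; $=0$ otherwise; extended multiplicatively to $S_n$ (permutations composed right to left). For $r\le n$, $S_r\subset S_n$ is the subgroup fixing $r+1,\ldots,n$. Last letter order on $\mathrm{SYT}(\lambda)$: for $T\ne S$, let $k$ be the largest entry lying in different rows in $T$ and $S$; then $T<S$ iff $k$ lies in a lower row (larger row index) in $T$ than in $S$. Write $T_1<T_2<\dots$ for the tableaux of shape $\lambda$ in this order and $\pi^\lambda(\sigma)_{i,j}=\pi^\lambda(\sigma)_{T_i,T_j}$.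 Partial sum: $PS^\lambda_u(\sigma):=\sum_{i,j\le u\dim\lambda}\pi^\lambda(\sigma)_{i,j}/\dim\lambda$. Total sum: $TS^\lambda(\sigma):=\sum_{i,j\le\dim\lambda}\pi^\lambda(\sigma)_{i,j}/\dim\lambda$. The Plancherel measure of size $n$ gives $\lambda\vdash n$ probability $(\dim\lambda)^2/n!$; $\mathbb{E}^r_{PL}$ is expectation under the Plancherel measure of size $r$. *)

(* Defs.v *)
From HB Require Import structures.
From mathcomp Require Import all_boot all_order all_algebra all_fingroup.
From mathcomp Require Import ring lra zify.

Set Implicit Arguments.
Unset Strict Implicit.
Unset Printing Implicit Defensive.

Import Order.TTheory GRing.Theory Num.Theory.
Local Open Scope ring_scope.

(* All indices start at 0: rows, columns and tableau entries are elements of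
   'I_n, the entry k standing for the letter k + 1 of the usual convention.
   Contents are unaffected. *)

(* The row lengths of the partition, padded with zeros to n rows. *)
Definition is_intpart n (f : {ffun 'I_n -> 'I_n.+1}) : bool :=
  [forall i : 'I_n, forall j : 'I_n, (i <= j)%N ==> (f j <= f i)%N]
  && (\sum_i (f i : nat) == n)%N.

Record intpart n := IntPart {
  rowlen :> {ffun 'I_n -> 'I_n.+1};
  rowlenP : is_intpart rowlen }.

HB.instance Definition _ n := [isSub for @rowlen n].
HB.instance Definition _ n := [Finite of intpart n by <:].

(* A box is a pair (row, column). *)
Definition diagram n (la : intpart n) : {set 'I_n * 'I_n} :=
  [set x : 'I_n * 'I_n | x.2 < la x.1]%N.

(* A tableau is encoded by the map sending each entry to the box containing
   it. *)
Definition is_syt n (la : intpart n) (T : {ffun 'I_n -> 'I_n * 'I_n}) : bool :=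
  [&& injectiveb T, [set T k | k : 'I_n] == diagram la,
      [forall k : 'I_n, forall l : 'I_n,
        ((T k).1 == (T l).1) && ((T k).2 < (T l).2)%N ==> (k < l)%N] &
      [forall k : 'I_n, forall l : 'I_n,
        ((T k).2 == (T l).2) && ((T k).1 < (T l).1)%N ==> (k < l)%N]].

Record syt n (la : intpart n) := Syt {
  syt_box :> {ffun 'I_n -> 'I_n * 'I_n};
  syt_boxP : is_syt la syt_box }.

HB.instance Definition _ n (la : intpart n) := [isSub for @syt_box n la].
HB.instance Definition _ n (la : intpart n) := [Finite of syt la by <:].

Definition dim_part n (la : intpart n) : nat := #|{: syt la}|.

Definition box_content n (T : {ffun 'I_n -> 'I_n * 'I_n}) (k : 'I_n) : int :=
  (T k).2%:Z - (T k).1%:Z.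

Definition llo_lt n (la : intpart n) (T S : syt la) : bool :=
  [exists k : 'I_n, ((S k).1 < (T k).1)%N
     && [forall l : 'I_n, (k < l)%N ==> ((T l).1 == (S l).1)]].

Definition llo_le n (la : intpart n) (T S : syt la) : bool :=
  (T == S) || llo_lt T S.

(* The i-th tableau of shape la in last letter order, i starting at 0. *)
Definition tab n (la : intpart n) (i : 'I_(dim_part la)) : syt la :=
  tnth [tuple of sort (@llo_le n la) (enum_tuple {: syt la})] i.

Definition swap_entries n (i j : 'I_n) (T : {ffun 'I_n -> 'I_n * 'I_n}) :
  {ffun 'I_n -> 'I_n * 'I_n} := [ffun k => T (tperm i j k)].

(* The matrix of the transposition (i, j), for j = i + 1.  The second case
   only occurs if exchanging i and j in [tab a] gives a standard tableau, that
   is, if i and j lie in different rows and columns. *)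
Definition young_gen (R : rcfType) n (la : intpart n) (i j : 'I_n) :
  'M[R]_(dim_part la) :=
  \matrix_(a, b)
    let T := tab a in
    let S := tab b in
    let d : R := (box_content T j - box_content T i)%:~R in
    if S == T then d^-1
    else if syt_box S == swap_entries i j T then Num.sqrt (1 - (d ^+ 2)^-1)
    else 0.

(* Products of permutations in the library compose from left to right, whereas
   rho is multiplicative for the composition from right to left: hence the
   exchange of s and t. *)
Definition is_young_rep (R : rcfType) n (la : intpart n)
    (rho : 'S_n -> 'M[R]_(dim_part la)) : Prop :=
  [/\ rho 1%g = 1%:M,
      forall s t : 'S_n, rho (t * s)%g = rho s *m rho t &
      forall i j : 'I_n, j = i.+1 :> nat -> rho (tperm i j) = young_gen R la i j].

(* The matrices above satisfy the Coxeter relations of the symmetric group. *)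
Module YoungForm.

Section Coxeter.
Variables (n : nat) (R : pzRingType) (f : 'I_n -> 'I_n -> R).
Hypothesis f_invol : forall i j : 'I_n, j = i.+1 :> nat -> f i j * f i j = 1.
Hypothesis f_comm : forall i j k l : 'I_n, j = i.+1 :> nat -> l = k.+1 :> nat ->
  (j < k)%N -> f i j * f k l = f k l * f i j.
Hypothesis f_braid : forall i j k : 'I_n, j = i.+1 :> nat -> k = j.+1 :> nat ->
  f i j * f j k * f i j = f j k * f i j * f j k.

Definition desc (s : 'S_n) (p : 'I_n * 'I_n) :=
  (p.2 == p.1.+1 :> nat) && (s p.2 < s p.1)%N.

Definition weight (s : 'S_n) : nat := \sum_(k < n) (k * s k)%N.

Lemma weight_le s : (weight s <= n * (n * n))%N.
Proof.
rewrite /weight -[X in (_ <= X * _)%N](card_ord n) -sum_nat_const.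
by apply: leq_sum => k _; rewrite leq_mul // ltnW.
Qed.

Lemma weight_swap s i j : desc s (i, j) ->
  (weight s < weight (tperm i j * s)%g)%N.
Proof.
case/andP=> /= /eqP ij lts.
have neq : j != i by apply/eqP => e; move: ij; rewrite e => /n_Sn.
rewrite /weight (bigD1 i) //= (bigD1 j) //=.
rewrite [X in (_ < X)%N](bigD1 i) //= [X in (_ < _ + X)%N](bigD1 j) //=.
rewrite !permM tpermL tpermR.
rewrite [X in (_ < _ + (_ + X))%N](eq_bigr (fun k : 'I_n => k * s k)%N); last first.
  by move=> k /andP[ki kj]; rewrite permM tpermD // eq_sym.
move: lts; rewrite ij; set S := \sum_(_ | _) _; move: S (s i) (s j); nia.
Qed.

Definition mu s := (n * (n * n) - weight s)%N.

Lemma mu_swap s i j : desc s (i, j) -> (mu (tperm i j * s)%g < mu s)%N.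
Proof.
move=> /weight_swap lt; rewrite /mu.
have := weight_le s; have := weight_le (tperm i j * s)%g.
lia.
Qed.

Fixpoint cox_rec N (s : 'S_n) : R :=
  if N is N'.+1 then
    if [pick p | desc s p] is Some p then
      cox_rec N' (tperm p.1 p.2 * s)%g * f p.1 p.2
    else 1
  else 1.

Definition cox s := cox_rec (mu s).+1 s.

Lemma cox_rec_eq N N' s : (mu s < N)%N -> (mu s < N')%N ->
  cox_rec N s = cox_rec N' s.
Proof.
elim: N N' s => [|N IH] [|N'] s //= h h'.
case: pickP => [[i j] /= d|//].
by have lt := mu_swap d; rewrite (IH N') //; lia.
Qed.

Lemma cox_nodesc s : (forall p, ~~ desc s p) -> cox s = 1.
Proof.
move=> nd; rewrite /cox /=; case: pickP => // p d.
by have := nd p; rewrite d.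
Qed.

Lemma cox_some s p : desc s p ->
  exists i j, desc s (i, j) /\ cox s = cox (tperm i j * s)%g * f i j.
Proof.
move=> dp; rewrite {1}/cox /=; case: pickP => [[i j] d|/(_ p)]; last by rewrite dp.
exists i, j; split => //=; congr (_ * _).
by apply: cox_rec_eq => //; apply: mu_swap.
Qed.

Lemma desc_adj s i j : desc s (i, j) -> j = i.+1 :> nat.
Proof. by case/andP => /eqP. Qed.

Lemma neq_of_lt (i j : 'I_n) : (i < j)%N -> (i == j = false) * (j == i = false).
Proof. by move=> lt; split; apply/eqP => e; move: lt; rewrite e ltnn. Qed.

Lemma coxD s i j : desc s (i, j) -> cox s = cox (tperm i j * s)%g * f i j.
Proof.
have [m] := ubnP (mu s); elim: m => // m IH in s i j *; rewrite ltnS => hm d.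
have [k [l [d' ->]]] := cox_some d.
have ij := desc_adj d; have kl := desc_adj d'.
wlog lt : i j k l d d' ij kl / (i <= k)%N.
  move=> W; case: (leqP i k) => [|/ltnW] h; first exact: W.
  by symmetry; apply: W.
have [ik|ik] := eqVneq i k.
  by move: kl d'; rewrite -ik -ij => /val_inj -> _.
have [jk|jk] := eqVneq j k.
  subst k.
  have lij : (i < j)%N by rewrite ij.
  have ljl : (j < l)%N by rewrite kl.
  have lil : (i < l)%N by apply: ltn_trans lij ljl.
  have E := (neq_of_lt lij, neq_of_lt ljl, neq_of_lt lil).
  case/andP: (d) => _ /= lsij; case/andP: (d') => _ /= lsjl.
  have mu1 := mu_swap d; have mu2 := mu_swap d'.
  have d1 : desc (tperm j l * s)%g (i, j).
    by rewrite /desc /= ij eqxx !permM tpermL tpermD ?E //= (ltn_trans lsjl).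
  have d2 : desc (tperm i j * s)%g (j, l).
    rewrite /desc /= kl eqxx !permM tpermR tpermD ?E //=.
    exact: ltn_trans lsij.
  have mu3 := mu_swap d1; have mu4 := mu_swap d2.
  have d3 : desc (tperm i j * (tperm j l * s))%g (j, l).
    by rewrite /desc /= kl eqxx !permM tpermR [tperm i j l]tpermD ?E // tpermR tpermD ?E.
  have d4 : desc (tperm j l * (tperm i j * s))%g (i, j).
    by rewrite /desc /= ij eqxx !permM [tperm j l i]tpermD ?E // !tpermL tpermD ?E.
  rewrite (IH _ _ _ _ d1); last by apply: leq_trans hm.
  rewrite (IH _ _ _ _ d2); last by apply: leq_trans hm.
  rewrite (IH _ _ _ _ d3); last by apply: leq_trans hm; apply: ltn_trans mu2.
  rewrite (IH _ _ _ _ d4); last by apply: leq_trans hm; apply: ltn_trans mu1.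
  have -> : (tperm i j * (tperm j l * (tperm i j * s)) =
             tperm j l * (tperm i j * (tperm j l * s)))%g.
    rewrite !mulgA; congr (_ * _)%g.
    apply/permP => x; rewrite !permM.
    have Ei := (tpermL i j, tpermR i j, tpermL j l, tpermR j l).
    have tl : tperm i j l = l by rewrite tpermD ?E.
    have ti : tperm j l i = i by rewrite tpermD ?E.
    have [->|xi] := eqVneq x i; first by rewrite !(Ei, tl, ti).
    have [->|xj] := eqVneq x j; first by rewrite !(Ei, tl, ti).
    have [->|xl] := eqVneq x l; first by rewrite !(Ei, tl, ti).
    have ni : tperm i j x = x by rewrite tpermD // eq_sym.
    have nj : tperm j l x = x by rewrite tpermD // eq_sym.
    by rewrite !(ni, nj).
  by rewrite -!mulrA; congr (_ * _); rewrite !mulrA f_braid.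
have jltk : (j < k)%N.
  rewrite ij; rewrite ltn_neqAle [X in _ && X]ltn_neqAle lt andbT.
  by rewrite -ij; apply/andP; split => //.
have lij : (i < j)%N by rewrite ij.
have lkl : (k < l)%N by rewrite kl.
have lik := ltn_trans lij jltk; have ljl := ltn_trans jltk lkl.
have lil := ltn_trans lij ljl.
have E := (neq_of_lt lij, neq_of_lt ljl, neq_of_lt lil, neq_of_lt lkl, neq_of_lt lik, neq_of_lt jltk).
have mu1 := mu_swap d; have mu2 := mu_swap d'.
case/andP: (d) => _ /= lsij; case/andP: (d') => _ /= lskl.
have d1 : desc (tperm k l * s)%g (i, j) by rewrite /desc /= ij eqxx !permM !tpermD ?E.
have d2 : desc (tperm i j * s)%g (k, l) by rewrite /desc /= kl eqxx !permM !tpermD ?E.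
rewrite (IH _ _ _ _ d1); last by apply: leq_trans hm.
rewrite (IH _ _ _ _ d2); last by apply: leq_trans hm.
rewrite -!mulrA f_comm // !mulgA; congr (cox (_ * _)%g * _).
apply/permP => x; rewrite !permM.
have Ei := (tpermL i j, tpermR i j, tpermL k l, tpermR k l).
have tk : tperm i j k = k by rewrite tpermD ?E.
have tl : tperm i j l = l by rewrite tpermD ?E.
have ti : tperm k l i = i by rewrite tpermD ?E.
have tj : tperm k l j = j by rewrite tpermD ?E.
have [->|xi] := eqVneq x i; first by rewrite !(Ei, ti, tj, tk, tl).
have [->|xj] := eqVneq x j; first by rewrite !(Ei, ti, tj, tk, tl).
have [->|xk] := eqVneq x k; first by rewrite !(Ei, ti, tj, tk, tl).
have [->|xl] := eqVneq x l; first by rewrite !(Ei, ti, tj, tk, tl).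
have ni : tperm i j x = x by rewrite tpermD // eq_sym.
have nj : tperm k l x = x by rewrite tpermD // eq_sym.
by rewrite !(ni, nj).
Qed.

Lemma cox_adj (s : 'S_n) (i j : 'I_n) : j = i.+1 :> nat -> cox (tperm i j * s)%g = cox s * f i j.
Proof.
move=> ij; have [d|nd] := boolP (desc s (i, j)).
  by rewrite (coxD d) -mulrA f_invol // mulr1.
have d : desc (tperm i j * s)%g (i, j).
  rewrite /desc /= ij eqxx !permM tpermL tpermR ltn_neqAle.
  move: nd; rewrite /desc /= ij eqxx /= -leqNgt => ->; rewrite andbT.
  apply/eqP => /val_inj/perm_inj e; move: ij; rewrite e; exact: n_Sn.
by rewrite (coxD d) mulgA tperm2 mul1g.
Qed.

Lemma cox1 : cox 1%g = 1.
Proof.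
by apply: cox_nodesc => -[i j]; apply/negP => /andP[/= /eqP ij]; rewrite !perm1 ij ltnNge leqnSn.
Qed.

Lemma nodesc_id (s : 'S_n) : (forall p, ~~ desc s p) -> s = 1%g.
Proof.
move=> nd.
have le (i : 'I_n) : (i <= s i)%N.
  case: i => m; elim: m => [|m IH] //= hm.
  have hm' : (m < n)%N := ltnW hm.
  apply: leq_ltn_trans (IH hm') _.
  have := nd (Ordinal hm', Ordinal hm); rewrite /desc /= eqxx /= -leqNgt.
  rewrite leq_eqVlt => /orP[/eqP/val_inj/perm_inj[] /n_Sn //|//].
have /eqP : (\sum_(i < n) i == \sum_(i < n) s i)%N.
  by rewrite [X in _ == X](reindex_inj (@perm_inj _ s^-1%g)) /=; apply/eqP/eq_bigr => i _; rewrite permKV.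
move/eqP; rewrite eq_sym => /eqP e; apply/permP => i; rewrite perm1; apply/val_inj/eqP.
have : (\sum_(i < n) (s i - i) = 0)%N by rewrite sumnB // e subnn.
move/eqP; rewrite sum_nat_eq0 => /forall_inP/(_ i isT).
by rewrite subn_eq0 eqn_leq => ->; rewrite le.
Qed.

Lemma coxM s t : cox (t * s)%g = cox s * cox t.
Proof.
have [m] := ubnP (mu t); elim: m => // m IH in t *; rewrite ltnS => hm.
have [/existsP[[i j] d]|nd] := boolP [exists p, desc t p]; last first.
  have -> : t = 1%g by apply: nodesc_id => p; apply: contraNN nd => d; apply/existsP; exists p.
  by rewrite mul1g cox1 mulr1.
rewrite (coxD d) mulrA -IH; last by apply: leq_trans hm; apply: mu_swap.
by rewrite -cox_adj ?(desc_adj d) // !mulgA tperm2 mul1g.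
Qed.

Lemma cox_gen (i j : 'I_n) : j = i.+1 :> nat -> cox (tperm i j) = f i j.
Proof. by move=> ij; rewrite -[tperm i j]mulg1 cox_adj // cox1 mul1r. Qed.

Lemma cox_unique (rho : 'S_n -> R) : rho 1%g = 1 ->
  (forall s t : 'S_n, rho (t * s)%g = rho s * rho t) ->
  (forall i j : 'I_n, j = i.+1 :> nat -> rho (tperm i j) = f i j) ->
  rho =1 cox.
Proof.
move=> rho1 rhoM rhof s.
have [m] := ubnP (mu s); elim: m => // m IH in s *; rewrite ltnS => hm.
have [/existsP[[i j] d]|nd] := boolP [exists p, desc s p]; last first.
  have -> : s = 1%g by apply: nodesc_id => p; apply: contraNN nd => d; apply/existsP; exists p.
  by rewrite rho1 cox1.
rewrite (coxD d) -(IH (tperm i j * s)%g); last by apply: leq_trans hm; apply: mu_swap.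
by rewrite -(rhof _ _ (desc_adj d)) -rhoM mulgA tperm2 mul1g.
Qed.

End Coxeter.

Section Relations.
Variables (R : rcfType) (n : nat) (la : intpart n).
Implicit Types i j k l : 'I_n.
Local Notation raw := {ffun 'I_n -> 'I_n * 'I_n}.

Lemma tab_inj : injective (@tab n la).
Proof. by apply/tuple_uniqP; rewrite sort_uniq enum_uniq. Qed.

Lemma tab_surj (T : syt la) : exists a, tab a = T.
Proof.
have /tnthP[a ->] : T \in [tuple of sort (@llo_le n la) (enum_tuple {: syt la})].
  by rewrite mem_sort mem_enum.
by exists a.
Qed.

Lemma rowlen_anti (i j : 'I_n) : (i <= j)%N -> (la j <= la i)%N.
Proof.
by have /andP[/forallP/(_ i)/forallP/(_ j)/implyP h _] := rowlenP la.
Qed.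

Lemma syt_inj (T : syt la) : injective T.
Proof. by have /and4P[/injectiveP] := syt_boxP T. Qed.

Lemma syt_dom (T : syt la) x : (x \in diagram la) = (x \in [set T k | k : 'I_n]).
Proof. by have /and4P[_ /eqP -> _ _] := syt_boxP T. Qed.

Lemma syt_in (T : syt la) k : T k \in diagram la.
Proof. by rewrite (syt_dom T) imset_f. Qed.

Lemma syt_row (T : syt la) (k l : 'I_n) :
  (T k).1 = (T l).1 -> ((T k).2 < (T l).2)%N -> (k < l)%N.
Proof.
have /and4P[_ _ /forallP/(_ k)/forallP/(_ l)/implyP h _] := syt_boxP T.
by move=> e lt; apply: h; rewrite e eqxx.
Qed.

Lemma syt_col (T : syt la) (k l : 'I_n) :
  (T k).2 = (T l).2 -> ((T k).1 < (T l).1)%N -> (k < l)%N.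
Proof.
have /and4P[_ _ _ /forallP/(_ k)/forallP/(_ l)/implyP h] := syt_boxP T.
by move=> e lt; apply: h; rewrite e eqxx.
Qed.

Lemma syt_between (T : syt la) (k l : 'I_n) :
  ((T k).1 < (T l).1)%N -> ((T k).2 < (T l).2)%N -> (k.+2 < l)%N.
Proof.
move=> lt1 lt2; have := syt_in T l; rewrite inE => inl.
have /imsetP[m1 _ e1] : ((T k).1, (T l).2) \in [set T k | k : 'I_n].
  by rewrite -syt_dom inE /=; apply: leq_trans inl (rowlen_anti (ltnW lt1)).
have /imsetP[m2 _ e2] : ((T l).1, (T k).2) \in [set T k | k : 'I_n].
  by rewrite -syt_dom inE /=; apply: ltn_trans inl.
have h1 : (k < m1)%N by apply: (@syt_row T); rewrite -e1.
have h2 : (m1 < l)%N by apply: (@syt_col T); rewrite -e1.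
have h3 : (k < m2)%N by apply: (@syt_col T); rewrite -e2.
have h4 : (m2 < l)%N by apply: (@syt_row T); rewrite -e2.
have h5 : m1 <> m2 :> nat.
  move=> /val_inj e; move: e1; rewrite e -e2 => -[e3 _].
  by move: lt1; rewrite e3 ltnn.
lia.
Qed.

Lemma content_neq (T : syt la) (k l : 'I_n) : (k < l)%N -> (l <= k.+2)%N ->
  box_content T l - box_content T k != 0.
Proof.
move=> kl lk; rewrite subr_eq0 /box_content; apply/eqP => e.
case: (ltngtP (T k).1 (T l).1) => [lt|lt|eq].
- have lt2 : ((T k).2 < (T l).2)%N by lia.
  by have := syt_between lt lt2; lia.
- have lt2 : ((T l).2 < (T k).2)%N by lia.
  by have := syt_between lt lt2; lia.
have eq2 : (T k).2 = (T l).2 by apply: val_inj => /=; lia.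
have : T k = T l by rewrite [T k]surjective_pairing [T l]surjective_pairing eq2 (val_inj eq).
by move/syt_inj => h; move: kl; rewrite h ltnn.
Qed.

Lemma swap_entriesK i j : involutive (@swap_entries n i j).
Proof. by move=> X; apply/ffunP => k; rewrite !ffunE tpermK. Qed.

Lemma swap_entries_neq (T : syt la) (i j : 'I_n) : j = i.+1 :> nat ->
  swap_entries i j T <> T.
Proof.
move=> ij /ffunP/(_ i); rewrite ffunE tpermL => /syt_inj e.
by move: ij; rewrite e => /n_Sn.
Qed.

Lemma tperm_lt (i j k l : 'I_n) : j = i.+1 :> nat -> (k < l)%N ->
  (k, l) <> (i, j) -> (tperm i j k < tperm i j l)%N.
Proof.
move=> ij kl ne.
have neV (x y : 'I_n) : x <> y -> x <> y :> nat by move=> h /val_inj.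
case: (tpermP i j k) => [ki|kj|/neV ki /neV kj];
  case: (tpermP i j l) => [li|lj|/neV li /neV lj]; try (subst; lia).
by case: ne; rewrite ki lj.
Qed.

Lemma swap_nstd (T : syt la) (i j : 'I_n) : j = i.+1 :> nat ->
  ~~ is_syt la (swap_entries i j T) ->
  (box_content T j - box_content T i) ^+ 2 = 1.
Proof.
move=> ij nstd.
have neij : i <> j by move=> e; move: ij; rewrite e => /n_Sn.
have [r|r] := eqVneq (T i).1 (T j).1.
  have lt : ((T i).2 < (T j).2)%N.
    case: (ltngtP (T i).2 (T j).2) => // [lt|eq].
      by have := syt_row (esym r) lt; lia.
    case: neij; apply: (@syt_inj T).
    by rewrite [T i]surjective_pairing [T j]surjective_pairing r (val_inj eq).
  have e : (T j).2 = (T i).2.+1 :> nat.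
    apply/eqP; rewrite eqn_leq lt andbT leqNgt; apply/negP => lt'.
    have hn : ((T i).2.+1 < n)%N by apply: ltn_trans lt' _.
    have /imsetP[m _ e] : ((T j).1, Ordinal hn) \in [set T k | k : 'I_n].
      by rewrite -syt_dom; have := syt_in T j; rewrite !inE /=; apply: ltn_trans.
    have h1 : (i < m)%N by apply: (@syt_row T); rewrite -e //=.
    have h2 : (m < j)%N by apply: (@syt_row T); rewrite -e //=.
    lia.
  by rewrite /box_content r e; lia.
have [c|c] := eqVneq (T i).2 (T j).2.
  have lt : ((T i).1 < (T j).1)%N.
    case: (ltngtP (T i).1 (T j).1) => // [lt|eq].
      by have := syt_col (esym c) lt; lia.
    by move: r; rewrite -val_eqE /= eq eqxx.
  have e : (T j).1 = (T i).1.+1 :> nat.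
    apply/eqP; rewrite eqn_leq lt andbT leqNgt; apply/negP => lt'.
    have hn : ((T i).1.+1 < n)%N by apply: ltn_trans lt' _.
    have /imsetP[m _ e] : (Ordinal hn, (T j).2) \in [set T k | k : 'I_n].
      rewrite -syt_dom; have := syt_in T j; rewrite !inE /= => h.
      by apply: leq_trans h _; apply: rowlen_anti; apply: ltnW.
    have h1 : (i < m)%N by apply: (@syt_col T); rewrite -e //=.
    have h2 : (m < j)%N by apply: (@syt_col T); rewrite -e //=.
    lia.
  by rewrite /box_content c e; lia.
case/negP: nstd; apply/and4P; split.
- by apply/injectiveP => k l; rewrite !ffunE => /syt_inj/perm_inj.
- apply/eqP/setP => x; rewrite (syt_dom T); apply/imsetP/imsetP => -[k _ ->].
    by exists (tperm i j k); rewrite ?ffunE.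
  by exists (tperm i j k); rewrite ?ffunE ?tpermK.
- apply/forallP => k; apply/forallP => l; apply/implyP; rewrite !ffunE => /andP[/eqP e lt].
  rewrite -[k](tpermK i j) -[l](tpermK i j); apply: tperm_lt => //.
    exact: syt_row lt.
  by case=> e1 e2; move: e; rewrite e1 e2; apply/eqP.
- apply/forallP => k; apply/forallP => l; apply/implyP; rewrite !ffunE => /andP[/eqP e lt].
  rewrite -[k](tpermK i j) -[l](tpermK i j); apply: tperm_lt => //.
    exact: syt_col lt.
  by case=> e1 e2; move: e; rewrite e1 e2; apply/eqP.
Qed.

Definition rdist (X : raw) i j : R := (box_content X j - box_content X i)%:~R.

Definition sq (d : R) : R := Num.sqrt (1 - (d ^+ 2)^-1).

Definition rawop i j (w : raw -> R) (X : raw) : R :=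
  (rdist X i j)^-1 * w X + sq (rdist X i j) * w (swap_entries i j X).

Definition ext (v : 'I_(dim_part la) -> R) (X : raw) : R :=
  \sum_(b | syt_box (tab b) == X) v b.

Definition agree (w w' : raw -> R) := forall X, is_syt la X -> w X = w' X.

Lemma ext_tab v a : ext v (tab a) = v a.
Proof.
rewrite /ext (bigD1 a) //= big1 ?addr0 // => b /andP[/eqP/val_inj/tab_inj ->].
by rewrite eqxx.
Qed.

Definition genop i j (v : 'I_(dim_part la) -> R) a : R :=
  \sum_b young_gen R la i j a b * v b.

Lemma ext_genop i j v : j = i.+1 :> nat ->
  agree (ext (genop i j v)) (rawop i j (ext v)).
Proof.
move=> ij X stdX; have [a ea] := tab_surj (Syt stdX).
have -> : X = tab a by rewrite ea.
rewrite ext_tab /genop /rawop /ext !big_distrr /= [X in X + _]big_mkcond [X in _ + X]big_mkcond -big_split /=.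
apply: eq_bigr => b _; rewrite mxE /= -[tab b == tab a]val_eqE /=.
case: eqP => [->|_].
  by case: eqP => [/esym/(swap_entries_neq ij)//|_]; rewrite addr0.
by case: eqP => [_|_]; rewrite add0r // mul0r.
Qed.

Lemma rdist_neq0 (T : syt la) (k l : 'I_n) : (k < l)%N -> (l <= k.+2)%N ->
  rdist T k l != 0.
Proof. by move=> kl lk; rewrite intr_eq0 content_neq. Qed.

Lemma rawop_agree i j w w' : j = i.+1 :> nat -> agree w w' ->
  agree (rawop i j w) (rawop i j w').
Proof.
move=> ij h X stdX; rewrite /rawop (h _ stdX).
have [std|nstd] := boolP (is_syt la (swap_entries i j X)).
  by rewrite (h _ std).
have e := @swap_nstd (Syt stdX) _ _ ij nstd.
have e' : rdist X i j ^+ 2 = 1 by rewrite -[RHS]/(1%:~R) -e rmorphXn.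
by rewrite /sq e' invr1 subrr sqrtr0 !mul0r.
Qed.

Lemma rdist_sw i j (X : raw) k l :
  rdist (swap_entries i j X) k l = rdist X (tperm i j k) (tperm i j l).
Proof. by rewrite /rdist /box_content !ffunE. Qed.

Lemma rdistN (X : raw) k l : rdist X k l = - rdist X l k.
Proof. by rewrite /rdist -mulrNz; congr (_%:~R); ring. Qed.

Lemma sqN d : sq (- d) = sq d. Proof. by rewrite /sq sqrrN. Qed.

Lemma sq_sqr (T : syt la) (k l : 'I_n) : (k < l)%N -> (l <= k.+2)%N ->
  sq (rdist T k l) * sq (rdist T k l) =
    1 - (rdist T k l)^-1 * (rdist T k l)^-1.
Proof.
move=> kl lk; rewrite -[LHS]expr2 sqr_sqrtr ?expr2 ?invfM // subr_ge0.
have neq := content_neq T kl lk.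
have e : rdist T k l ^+ 2 = ((box_content T l - box_content T k) ^+ 2)%:~R.
  by rewrite rmorphXn.
rewrite -invfM -expr2 e invf_le1 ?ltr0z ?ler1z; first by nia.
by nia.
Qed.

Lemma mx_genop i j (M : 'M[R]_(dim_part la)) a b :
  (young_gen R la i j *m M) a b = genop i j (M^~ b) a.
Proof. by rewrite mxE. Qed.

Lemma young_gen_invol i j : j = i.+1 :> nat ->
  young_gen R la i j *m young_gen R la i j = 1%:M.
Proof.
move=> ij; apply/matrixP => a b.
rewrite -[X in _ *m X]mulmx1 mx_genop.
rewrite -ext_tab (ext_genop _ ij) ?syt_boxP //.
rewrite (rawop_agree (w' := rawop i j (ext ((1%:M : 'M[R]_(dim_part la))^~ b))) ij) ?syt_boxP //; last first.
  by move=> X sX; rewrite -(ext_genop _ ij) //; apply: eq_bigr => c _; rewrite mx_genop.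
set w := ext _; rewrite /rawop swap_entriesK !rdist_sw tpermL tpermR.
rewrite [rdist _ j i]rdistN sqN invrN.
have h1 : (i < j)%N by rewrite ij.
have h2 : (j <= i.+2)%N by rewrite ij.
have := sq_sqr (tab a) h1 h2.
set A := (rdist _ _ _)^-1; set g := sq _ => E.
rewrite -[RHS](ext_tab ((1%:M : 'M[R]_(dim_part la))^~ b)) -/w.
transitivity ((g * g - (1 - A * A)) * w (tab a) + w (tab a)); last by rewrite E; ring.
ring.
Qed.

Lemma young_gen2 i j k l (M : 'M[R]_(dim_part la)) a b :
  j = i.+1 :> nat -> l = k.+1 :> nat ->
  (young_gen R la i j *m (young_gen R la k l *m M)) a b =
  rawop i j (rawop k l (ext (M^~ b))) (tab a).
Proof.
move=> ij kl; rewrite mx_genop -ext_tab (ext_genop _ ij) ?syt_boxP //.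
apply: (rawop_agree ij); last exact: syt_boxP.
by move=> X sX; rewrite -(ext_genop _ kl) //; apply: eq_bigr => c _; rewrite mx_genop.
Qed.

Lemma young_gen_comm i j k l : j = i.+1 :> nat -> l = k.+1 :> nat -> (j < k)%N ->
  young_gen R la i j *m young_gen R la k l =
  young_gen R la k l *m young_gen R la i j.
Proof.
move=> ij kl jk; apply/matrixP => a b.
rewrite -[X in _ *m X]mulmx1 -[X in _ = (_ *m X) _ _]mulmx1 !young_gen2 //.
have lij : (i < j)%N by rewrite ij.
have lkl : (k < l)%N by rewrite kl.
have lik := ltn_trans lij jk; have ljl := ltn_trans jk lkl.
have lil := ltn_trans lij ljl.
have E := (neq_of_lt lij, neq_of_lt ljl, neq_of_lt lil, neq_of_lt lkl, neq_of_lt lik, neq_of_lt jk).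
set w := ext _; rewrite /rawop !rdist_sw.
rewrite !tpermD ?E //.
have -> : swap_entries i j (swap_entries k l (tab a)) =
          swap_entries k l (swap_entries i j (tab a)).
  apply/ffunP => x; rewrite !ffunE; congr (tab a _).
  have Ei := (tpermL i j, tpermR i j, tpermL k l, tpermR k l).
  have tk : tperm i j k = k by rewrite tpermD ?E.
  have tl : tperm i j l = l by rewrite tpermD ?E.
  have ti : tperm k l i = i by rewrite tpermD ?E.
  have tj : tperm k l j = j by rewrite tpermD ?E.
  have [->|xi] := eqVneq x i; first by rewrite !(Ei, ti, tj, tk, tl).
  have [->|xj] := eqVneq x j; first by rewrite !(Ei, ti, tj, tk, tl).
  have [->|xk] := eqVneq x k; first by rewrite !(Ei, ti, tj, tk, tl).
  have [->|xl] := eqVneq x l; first by rewrite !(Ei, ti, tj, tk, tl).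
  have ni : tperm i j x = x by rewrite tpermD // eq_sym.
  have nj : tperm k l x = x by rewrite tpermD // eq_sym.
  by rewrite !(ni, nj).
ring.
Qed.

Lemma young_gen_braid i j k : j = i.+1 :> nat -> k = j.+1 :> nat ->
  young_gen R la i j *m young_gen R la j k *m young_gen R la i j =
  young_gen R la j k *m young_gen R la i j *m young_gen R la j k.
Proof.
move=> ij jk; apply/matrixP => a b.
rewrite -[LHS]/((_ *m _ *m _) a b) -[X in (_ *m X) a b = _]mulmx1 -[X in _ = (_ *m X) a b]mulmx1.
rewrite -!mulmxA !young_gen2 //.
set v := (1%:M : 'M[R]_(dim_part la))^~ b.
have aux k1 k2 : k2 = k1.+1 :> nat ->
    agree (ext ((young_gen R la k1 k2 *m 1%:M)^~ b)) (rawop k1 k2 (ext v)).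
  move=> e X sX; rewrite -(ext_genop _ e) //; apply: eq_bigr => c _.
  by rewrite mx_genop.
rewrite (rawop_agree ij (rawop_agree jk (aux _ _ ij))) ?syt_boxP //.
rewrite (rawop_agree jk (rawop_agree ij (aux _ _ jk))) ?syt_boxP //.
set w := ext _; rewrite /rawop !swap_entriesK !rdist_sw.
have lij : (i < j)%N by rewrite ij.
have ljk : (j < k)%N by rewrite jk.
have lik := ltn_trans lij ljk.
have E := (neq_of_lt lij, neq_of_lt ljk, neq_of_lt lik).
have tk : tperm i j k = k by rewrite tpermD ?E.
have ti : tperm j k i = i by rewrite tpermD ?E.
have Ei := (tpermL i j, tpermR i j, tpermL j k, tpermR j k, tk, ti).
rewrite !Ei.
have -> : swap_entries i j (swap_entries j k (swap_entries i j (tab a))) =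
          swap_entries j k (swap_entries i j (swap_entries j k (tab a))).
  apply/ffunP => x; rewrite !ffunE; congr (tab a _).
  have [->|xi] := eqVneq x i; first by rewrite !Ei.
  have [->|xj] := eqVneq x j; first by rewrite !Ei.
  have [->|xk] := eqVneq x k; first by rewrite !Ei.
  have ni : tperm i j x = x by rewrite tpermD // eq_sym.
  have nj : tperm j k x = x by rewrite tpermD // eq_sym.
  by rewrite !(ni, nj).
rewrite [rdist _ j i]rdistN [rdist _ k j]rdistN !sqN !invrN.
have h1 : (j <= i.+2)%N by rewrite ij.
have h2 : (k <= j.+2)%N by rewrite jk.
have h3 : (k <= i.+2)%N by rewrite jk ij.
have Ep := sq_sqr (tab a) lij h1; have Eq := sq_sqr (tab a) ljk h2.
have np := rdist_neq0 (tab a) lij h1.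
have nq := rdist_neq0 (tab a) ljk h2.
have ns := rdist_neq0 (tab a) lik h3.
have es : rdist (tab a) i k = rdist (tab a) i j + rdist (tab a) j k.
  by rewrite /rdist -intrD; congr (_%:~R); ring.
have E1 : (rdist (tab a) i j)^-1 * (rdist (tab a) j k)^-1 =
  (rdist (tab a) i k)^-1 * ((rdist (tab a) i j)^-1 + (rdist (tab a) j k)^-1).
  rewrite es; rewrite es in ns; move: np nq ns.
  by move: (rdist _ i j) (rdist _ j k) => p q np nq ns; field; apply/and3P; split.
move: Ep Eq E1; set A := (rdist _ i j)^-1; set B := (rdist _ j k)^-1.
set C := (rdist _ i k)^-1; set gp := sq (rdist _ i j); set gq := sq (rdist _ j k).
set gs := sq (rdist _ i k) => Ep Eq E1.
apply/eqP; rewrite -subr_eq0; apply/eqP.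
set w1 := w (swap_entries i j (tab a)); set w2 := w (swap_entries j k (tab a)).
transitivity (w (tab a) * ((A - B) * (A * B - C * (A + B)) +
     C * ((gp * gp - (1 - A * A)) - (gq * gq - (1 - B * B)))) +
     (gp * w1 - gq * w2) * (A * B - C * (A + B))); last by rewrite E1 Ep Eq !subrr; ring.
ring.
Qed.

Let gen i j : 'M[R]_(dim_part la) := young_gen R la i j.

Lemma gen_invol i j : j = i.+1 :> nat -> gen i j * gen i j = 1.
Proof. exact: young_gen_invol. Qed.

Lemma gen_comm i j k l : j = i.+1 :> nat -> l = k.+1 :> nat -> (j < k)%N ->
  gen i j * gen k l = gen k l * gen i j.
Proof. exact: young_gen_comm. Qed.

Lemma gen_braid i j k : j = i.+1 :> nat -> k = j.+1 :> nat ->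
  gen i j * gen j k * gen i j = gen j k * gen i j * gen j k.
Proof. exact: young_gen_braid. Qed.

Lemma is_young_rep_cox : is_young_rep (cox gen).
Proof.
split; first exact: cox1.
  exact: (coxM gen_invol gen_comm gen_braid).
exact: (cox_gen gen_invol gen_comm gen_braid).
Qed.

Lemma is_young_rep_eq rho : is_young_rep rho -> rho =1 cox gen.
Proof.
by case=> h1 hM hg; apply: (cox_unique gen_comm gen_braid).
Qed.

End Relations.

End YoungForm.

Lemma young_rep_exists (R : rcfType) n (la : intpart n) :
  {rho : 'S_n -> 'M[R]_(dim_part la) | is_young_rep rho}.
Proof. by eexists; apply: YoungForm.is_young_rep_cox. Qed.

Lemma young_rep_unique (R : rcfType) n (la : intpart n)
    (rho rho' : 'S_n -> 'M[R]_(dim_part la)) :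
  is_young_rep rho -> is_young_rep rho' -> rho =1 rho'.
Proof.
by move=> h h' s; rewrite (YoungForm.is_young_rep_eq h) (YoungForm.is_young_rep_eq h').
Qed.

Definition young_rep (R : rcfType) n (la : intpart n) :
  'S_n -> 'M[R]_(dim_part la) := sval (young_rep_exists R la).

Lemma young_repP (R : rcfType) n (la : intpart n) :
  is_young_rep (young_rep R la).
Proof. exact: svalP (young_rep_exists R la). Qed.

Definition total_sum (R : rcfType) n (la : intpart n) (s : 'S_n) : R :=
  \sum_i \sum_j young_rep R la s i j / (dim_part la)%:R.

Definition partial_sum (R : rcfType) n (la : intpart n) (u : R) (s : 'S_n) : R :=
  \sum_(i < dim_part la | i.+1%:R <= u * (dim_part la)%:R)
    \sum_(j < dim_part la | j.+1%:R <= u * (dim_part la)%:R)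
      young_rep R la s i j / (dim_part la)%:R.

Definition plancherel (R : rcfType) n (la : intpart n) : R :=
  (dim_part la)%:R ^+ 2 / n`!%:R.

Definition plancherel_prob (R : rcfType) n (A : pred (intpart n)) : R :=
  \sum_(la | A la) plancherel R la.

Definition plancherel_expect (R : rcfType) n (X : intpart n -> R) : R :=
  \sum_la plancherel R la * X la.

(* The embedding of S_r as the subgroup of S_(r + m) fixing the last m
   letters. *)
Definition widen_perm_fun r m (s : 'S_r) (i : 'I_(r + m)) : 'I_(r + m) :=
  match split i with
  | inl j => lshift m (s j)
  | inr k => rshift r k
  end.

Lemma widen_perm_inj r m (s : 'S_r) : injective (@widen_perm_fun r m s).
Proof.
move=> i i'; rewrite /widen_perm_fun.
case: splitP => [j ij|k ik]; case: splitP => [j' ij'|k' ik'] e.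
- move/lshift_inj/perm_inj: e => e; apply: val_inj.
  by rewrite /= ij ij' e.
- by move/eqP: e; rewrite eq_lrshift.
- by move/eqP: e; rewrite eq_rlshift.
- by move/rshift_inj: e => e; apply: val_inj; rewrite /= ik ik' e.
Qed.

Definition widen_perm r m (s : 'S_r) : 'S_(r + m) :=
  perm (@widen_perm_inj r m s).

(* Main.v *)
Require Import Defs.
From mathcomp Require Import all_boot all_order all_algebra all_fingroup.
From mathcomp Require Import classical_sets reals topology normedtype sequences.
From mathcomp Require Import ring lra zify.

(* The first letters of a tableau T in SYT(la) on which sigma acts form a smaller
   tableau, and the sum of the row T of pi^la(sigma) only depends on that smaller
   tableau.  In last letter order, the tableaux with the same box for the letter
   n are consecutive, and removing n identifies such a block with SYT(mu) for a
   partition mu covered by la.  So, up to an error of the size of one block, PS_u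
   is a sum over complete blocks of the row sums; pi^la(sigma) is orthogonal,
   whence the bound on the incomplete block.

   Blocks are small: the sum over la of the (dim mu)^2 for mu covered by la is at
   most n! (1 + sqrt (2 n)) / n, since a partition of n - 1 has at most
   1 + sqrt (2 n) covers.

   Within a complete block the row sums average to m_sigma, in mean square: their
   deviations from m_sigma, summed over SYT(mu), are the values at mu of U^k g,
   where U is the up operator of Young's lattice, D its adjoint, and g lives in
   size r and is orthogonal to dim, that is, D^r g = 0.  From DU - UD = 1 one gets
   |U^k g|^2 = O(k! k^(r-1)), which is small compared to (k + r)!. *)

Set Implicit Arguments.
Unset Strict Implicit.
Unset Printing Implicit Defensive.

Import Order.TTheory GRing.Theory Num.Theory numFieldNormedType.Exports.
Local Open Scope ring_scope.

(** * Young's lattice *)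

(** Row lengths are extended by zero to all of [nat], so that partitions of different sizes can be
    compared row by row. *)
Definition part n (mu : intpart n) (i : nat) : nat :=
  if (insub i : option 'I_n) is Some o then mu o else 0%N.

Definition antitone (g : nat -> nat) := forall i, (g i.+1 <= g i)%N.

Lemma antitone_le g i j : antitone g -> (i <= j)%N -> (g j <= g i)%N.
Proof.
move=> ag; elim: j => [|j IH]; first by rewrite leqn0 => /eqP ->.
rewrite leq_eqVlt => /predU1P[-> //|]; rewrite ltnS => /IH.
exact: leq_trans (ag j).
Qed.

Section PartFacts.
Variable n : nat.
Implicit Types mu nu : intpart n.

Lemma part_ord mu (i : 'I_n) : part mu i = mu i.
Proof. by rewrite /part valK. Qed.

Lemma part_out mu i : (n <= i)%N -> part mu i = 0%N.
Proof. by move=> h; rewrite /part insubN // -leqNgt. Qed.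

Lemma part_anti mu : antitone (part mu).
Proof.
move=> i; case: (ltnP i.+1 n) => [h|h]; last by rewrite (part_out _ h).
rewrite -[i.+1]/(val (Ordinal h)) -[i in leqRHS]/(val (Ordinal (ltnW h))) !part_ord.
exact: YoungForm.rowlen_anti.
Qed.

Lemma part_inj mu nu : part mu =1 part nu -> mu = nu.
Proof.
move=> e; apply/val_inj/ffunP => i; apply/val_inj.
by have := e i; rewrite !part_ord.
Qed.

Lemma sum_part mu K : (n <= K)%N -> (\sum_(i < K) part mu i)%N = n.
Proof.
move=> h; rewrite -(subnKC h) big_split_ord /= [X in (_ + X)%N]big1 ?addn0; last first.
  by move=> i _; rewrite part_out // leq_addr.
rewrite (eq_bigr (fun i => mu i : nat)); last by move=> i _; rewrite part_ord.
by have /andP[_ /eqP] := rowlenP mu.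
Qed.

Lemma antitone_last0 g : antitone g -> (\sum_(i < n.+1) g i)%N = n -> g n = 0%N.
Proof.
move=> ag s; apply/eqP; rewrite -leqn0 leqNgt; apply/negP => gn.
have : (\sum_(i < n.+1) 1 <= \sum_(i < n.+1) g i)%N.
  by apply: leq_sum => i _; apply: leq_trans gn (antitone_le ag _); rewrite -ltnS.
by rewrite s sum1_card card_ord ltnn.
Qed.

(** The sum includes one term beyond the last possible row. This forces [g n = 0], as otherwise
    [n.+1] terms would be positive, and then [g] vanishes from [n] on. *)
Lemma part_exists g : antitone g -> (\sum_(i < n.+1) g i)%N = n ->
  exists mu, part mu =1 g.
Proof.
move=> ag s; have gn := antitone_last0 ag s.
have s' : (\sum_(i < n) g i)%N = n by move: s; rewrite big_ord_recr /= gn addn0.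
have gle (i : 'I_n) : (g i < n.+1)%N.
  by rewrite ltnS -[leqRHS]s' (bigD1 i) //= leq_addr.
have P : is_intpart [ffun i : 'I_n => Ordinal (gle i)].
  apply/andP; split.
    apply/forallP => i; apply/forallP => j; apply/implyP => ij; rewrite !ffunE /=.
    exact: antitone_le.
  by rewrite -[X in _ == X]s'; apply/eqP/eq_bigr => i _; rewrite ffunE.
exists (IntPart P) => i; case: (ltnP i n) => h.
  by rewrite -[i]/(val (Ordinal h)) part_ord /= ffunE.
rewrite part_out //; apply/esym/eqP; rewrite -leqn0 -[leqRHS]gn.
exact: antitone_le.
Qed.

End PartFacts.

(** * The covering relation of Young's lattice *)

Section Cover.
Variable n : nat.
Implicit Types (mu : intpart n) (la : intpart n.+1).

Definition covr (i : nat) mu la : bool :=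
  [forall j : 'I_n.+1, part la j == (part mu j + (j == i :> nat))%N].

Definition cov mu la : bool := [exists i : 'I_n.+1, covr i mu la].

Lemma covrP (i : 'I_n.+1) mu la :
  reflect (forall j, part la j = part mu j + (j == i))%N (covr i mu la).
Proof.
apply: (iffP forallP) => [h j|h j]; last by rewrite h.
case: (ltnP j n.+1) => hj; first exact: (eqP (h (Ordinal hj))).
rewrite !part_out ?(ltnW hj) //; case: eqP => // e.
by move: hj; rewrite e ltnNge -ltnS ltn_ord.
Qed.

Lemma covP mu la :
  reflect (exists i : 'I_n.+1, forall j, part la j = part mu j + (j == i))%N
          (cov mu la).
Proof.
by apply: (iffP existsP) => -[i /covrP h]; exists i => //; apply/covrP.
Qed.

Lemma covr_fun (i i' : 'I_n.+1) mu la : covr i mu la -> covr i' mu la -> i = i'.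
Proof.
move=> /covrP h /covrP h'; apply/val_inj.
by have := h i; rewrite h' eqxx; case: eqP => //; lia.
Qed.

Lemma covr_down (i : 'I_n.+1) mu mu' la : covr i mu la -> covr i mu' la -> mu = mu'.
Proof.
by move=> /covrP h /covrP h'; apply: part_inj => j; have := h j; rewrite h'; lia.
Qed.

Lemma covr_up (i : 'I_n.+1) mu la la' : covr i mu la -> covr i mu la' -> la = la'.
Proof. by move=> /covrP h /covrP h'; apply: part_inj => j; rewrite h h'. Qed.

Lemma sum_step g (i : 'I_n.+1) :
  (\sum_(j < n.+1) (g j + (j == i)))%N = (\sum_(j < n.+1) g j).+1.
Proof.
rewrite big_split /= [X in (_ + X)%N](bigD1 i) //= eqxx.
rewrite [X in (_ + (_ + X))%N]big1 ?addn0 ?addn1 // => j.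
by rewrite -val_eqE => /negbTE ->.
Qed.

Lemma covr_up_exists (i : 'I_n.+1) mu :
  (0 < i -> part mu i < part mu i.-1)%N -> exists la, covr i mu la.
Proof.
move=> h; pose g j := (part mu j + (j == i :> nat))%N.
have ag : antitone g.
  move=> j; rewrite /g; have := part_anti mu j.
  case: (eqVneq j.+1 i) => [e|_]; last by lia.
  by move: h; rewrite -e => /(_ isT) /=; lia.
have sg : (\sum_(j < n.+2) g j)%N = n.+1.
  rewrite big_ord_recr /= {2}/g part_out ?leqnSn // add0n gtn_eqF // addn0.
  by rewrite /g; have := sum_step (part mu) i; rewrite sum_part.
by have [la e] := part_exists ag sg; exists la; apply/covrP => j; rewrite e.
Qed.

Lemma covr_up_rem (i : 'I_n.+1) mu la : covr i mu la ->
  (0 < i -> part mu i < part mu i.-1)%N.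
Proof.
move=> /covrP h; case: i h => [[|i] hi] //= h _.
have := part_anti la i; rewrite !h eqxx /=; case: eqP => [/n_Sn //|_]; lia.
Qed.

Lemma covr_down_exists (i : 'I_n.+1) la :
  (part la i.+1 < part la i)%N -> exists mu, covr i mu la.
Proof.
move=> h; pose g j := (part la j - (j == i :> nat))%N.
have ag : antitone g.
  move=> j; rewrite /g; have := part_anti la j.
  case: (eqVneq j i) => [->|ne]; last by lia.
  by move: h => /=; rewrite gtn_eqF //; lia.
have gE j : part la j = (g j + (j == i))%N by rewrite /g; case: eqP => [->|_]; lia.
have sg : (\sum_(j < n.+1) g j)%N = n.
  apply/succn_inj; rewrite -(sum_step g i) -[RHS](sum_part la (leqnn _)).
  by apply: eq_bigr => j _; rewrite gE.
by have [mu e] := part_exists ag sg; exists mu; apply/covrP => j; rewrite e.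
Qed.

Lemma covr_down_rem (i : 'I_n.+1) mu la : covr i mu la -> (part la i.+1 < part la i)%N.
Proof.
by move=> /covrP h; rewrite !h eqxx gtn_eqF //; have := part_anti mu i; lia.
Qed.

End Cover.

Section BigCov.
Variables (R : zmodType) (n : nat).

Lemma big_cov_down (la : intpart n.+1) (G : intpart n -> R) :
  \sum_(mu | cov mu la) G mu = \sum_(i < n.+1) \sum_(mu | covr i mu la) G mu.
Proof.
under [RHS]eq_bigr do rewrite big_mkcond; rewrite exchange_big /= big_mkcond.
apply: eq_bigr => mu _; case: ifPn => [/existsP[i hi]|].
  rewrite (bigD1 i) //= hi big1 ?addr0 // => j ji; case: ifP => // hj.
  by move: ji; rewrite (covr_fun hj hi) eqxx.
by rewrite negb_exists => /forallP h; rewrite big1 // => i _; rewrite (negbTE (h i)).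
Qed.

End BigCov.

(** * Counting covers *)

Definition corners n (mu : intpart n) : nat :=
  (\sum_(i < n) (part mu i.+1 < part mu i))%N.

(** With [c] strict descents the sum is at least 1 + ... + c. The bound on [g 0] is carried along
    because the induction peels off the first row. *)
Lemma descents_le g K : antitone g ->
  let c := (\sum_(i < K) (g i.+1 < g i))%N in
  (c <= g 0)%N /\ (c * c.+1 <= 2 * \sum_(i < K) g i)%N.
Proof.
elim: K g => [|K IH] g ag /=; first by rewrite !big_ord0.
rewrite !big_ord_recl /=.
have [] := IH (fun i => g i.+1) (fun i => ag i.+1).
set c := (\sum_(i < K) _)%N; set s := (\sum_(i < K) _)%N => h1 h2.
rewrite -[X in (_ + X)%N]/c -[X in (_ * (_ + X))%N]/s.
by have := ag 0%N; case: (ltnP (g 1%N) (g 0%N)) => /=; split; nia.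
Qed.

Lemma corners_le n (mu : intpart n) : (corners mu ^ 2 <= 2 * n)%N.
Proof.
have [_] := descents_le n (part_anti mu).
rewrite -/(corners mu) sum_part // => h; nia.
Qed.

(** A box is removable exactly when it ends a row strictly longer than the next one. *)
Lemma card_cov_down n (la : intpart n.+1) : #|[pred mu | cov mu la]| = corners la.
Proof.
rewrite -sum1_card /corners.
transitivity (\sum_(i < n.+1) \sum_(mu | covr i mu la) 1)%N.
  under [RHS]eq_bigr do rewrite big_mkcond; rewrite exchange_big /= big_mkcond.
  apply: eq_bigr => mu _; rewrite inE; case: ifPn => [/existsP[i hi]|].
    rewrite (bigD1 i) //= hi big1 ?addn0 // => j ji; case: ifP => // hj.
    by move: ji; rewrite (covr_fun hj hi) eqxx.
  by rewrite negb_exists => /forallP h; rewrite big1 // => i _; rewrite (negbTE (h i)).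
apply: eq_bigr => i _; case: ltnP => h.
  have [mu hmu] := covr_down_exists h.
  rewrite (bigD1 mu) //= big1 // => mu' /andP[h' ne].
  by move: ne; rewrite (covr_down h' hmu) eqxx.
rewrite big1 // => mu /covr_down_rem; lia.
Qed.

(** A box can be added to row 0 and to each row just below one that ends in a removable box. The one
    extra cover is the diagonal part of DU - UD = 1. *)
Lemma card_cov_up n (mu : intpart n) : #|[pred la | cov mu la]| = (corners mu).+1.
Proof.
rewrite -sum1_card /corners.
transitivity (\sum_(i < n.+1) \sum_(la | covr i mu la) 1)%N.
  under [RHS]eq_bigr do rewrite big_mkcond; rewrite exchange_big /= big_mkcond.
  apply: eq_bigr => la _; rewrite inE; case: ifPn => [/existsP[i hi]|].
    rewrite (bigD1 i) //= hi big1 ?addn0 // => j ji; case: ifP => // hj.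
    by move: ji; rewrite (covr_fun hj hi) eqxx.
  by rewrite negb_exists => /forallP h; rewrite big1 // => i _; rewrite (negbTE (h i)).
have E (i : 'I_n.+1) : (\sum_(la | covr i mu la) 1)%N =
    ((0 < i) ==> (part mu i < part mu i.-1))%N :> nat.
  case: implyP => h.
    have [la hla] := covr_up_exists h.
    rewrite (bigD1 la) //= big1 // => la' /andP[h' ne].
    by move: ne; rewrite (covr_up h' hla) eqxx.
  by rewrite big1 // => la /covr_up_rem.
by rewrite (eq_bigr _ (fun i _ => E i)) big_ord_recl /= add1n; congr _.+1; apply: eq_bigr.
Qed.

(* The only possible common cover and commonly covered partition are the
   componentwise maximum and minimum. *)
Lemma card_cov_comm n (mu nu : intpart n.+1) : mu != nu ->
  #|[pred la | cov mu la && cov nu la]| = #|[pred ka | cov ka mu && cov ka nu]|.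
Proof.
move=> ne.
have ue (la : intpart n.+2) : cov mu la -> cov nu la ->
    (forall j, part la j = maxn (part mu j) (part nu j)).
  move=> /covP[i hi] /covP[i' hi'] j.
  have [e|ii] := eqVneq i i'.
    case/eqP: ne; apply: part_inj => k; have := hi k; rewrite hi' e; lia.
  have := hi j; have := hi' j; case: eqP => [->|_]; last by case: eqP; lia.
  by rewrite eq_sym val_eqE (negbTE ii); lia.
have de (ka : intpart n) : cov ka mu -> cov ka nu ->
    (forall j, part ka j = minn (part mu j) (part nu j)).
  move=> /covP[i hi] /covP[i' hi'] j.
  have [e|ii] := eqVneq i i'.
    by case/eqP: ne; apply: part_inj => k; rewrite hi hi' e.
  have := hi j; have := hi' j; case: eqP => [->|_]; last by case: eqP; lia.
  by rewrite eq_sym val_eqE (negbTE ii); lia.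
have u1 : (#|[pred la | cov mu la && cov nu la]| <= 1)%N.
  apply/card_le1P => la; rewrite inE => /andP[h1 h2] la'; rewrite !inE.
  apply/andP/eqP => [[h1' h2']|->//]; apply: part_inj => j.
  by rewrite (ue _ h1 h2) (ue _ h1' h2').
have d1 : (#|[pred ka | cov ka mu && cov ka nu]| <= 1)%N.
  apply/card_le1P => la; rewrite inE => /andP[h1 h2] la'; rewrite !inE.
  apply/andP/eqP => [[h1' h2']|->//]; apply: part_inj => j.
  by rewrite (de _ h1 h2) (de _ h1' h2').
(* Maximum and minimum add up to the sum, so the maximum has size [n.+2] exactly when the minimum
   has size [n]. *)
have smm K : (\sum_(j < K) maxn (part mu j) (part nu j) +
    \sum_(j < K) minn (part mu j) (part nu j) =
    \sum_(j < K) part mu j + \sum_(j < K) part nu j)%N.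
  by rewrite -!big_split /=; apply: eq_bigr => j _; lia.
have amax : antitone (fun j => maxn (part mu j) (part nu j)).
  by move=> j; have := part_anti mu j; have := part_anti nu j; lia.
have amin : antitone (fun j => minn (part mu j) (part nu j)).
  by move=> j; have := part_anti mu j; have := part_anti nu j; lia.
suff : (0 < #|[pred la | cov mu la && cov nu la]|)%N =
       (0 < #|[pred ka | cov ka mu && cov ka nu]|)%N by lia.
apply/card_gt0P/card_gt0P => -[x]; rewrite inE => /andP[c1 c2].
- have e := ue _ c1 c2; case/covP: c1 => i hi; case/covP: c2 => i' hi'.
  have [ka hka] : exists ka : intpart n, part ka =1 (fun j => minn (part mu j) (part nu j)).
    apply: part_exists => //; have := smm n.+2.
    have -> : (\sum_(j < n.+2) maxn (part mu j) (part nu j) = n.+2)%N.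
      by rewrite -[RHS](sum_part x (leqnn _)); apply: eq_bigr => j _; rewrite e.
    rewrite !sum_part ?leqnSn // big_ord_recr /= !(part_out _ (leqnn n.+1)); lia.
  (* At row [i0] the cover [x] is longer than [y], so its length there is that of [z]. A nonzero row
     of [z] has index below [n.+1], as required for a row where a box is added to a partition of
     [n]. *)
  have lt (i0 : 'I_n.+2) (y z : intpart n.+1) : y != z ->
     (forall j, part x j = maxn (part y j) (part z j)) ->
     (forall j, part x j = part y j + (j == i0))%N -> (i0 < n.+1)%N.
    move=> yz ex hx.
    have := hx i0; rewrite eqxx ex => h.
    by rewrite ltnNge; apply/negP => h'; move: h; rewrite !part_out // ltnW.
  have l1 := lt _ _ _ ne e hi.
  have e' j : part x j = maxn (part nu j) (part mu j) by rewrite maxnC.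
  have l2 := lt _ _ _ (contra_neq (@esym _ _ _) ne) e' hi'.
  have ii : (i == i' :> nat) = false.
    apply/eqP => /val_inj ii; case/eqP: ne; apply: part_inj => k.
    by have := hi k; rewrite hi' ii; lia.
  exists ka; rewrite inE; apply/andP; split; apply/covP.
    exists (Ordinal l2) => j; rewrite hka -[j == _]/(j == i' :> nat).
    by have := hi j; have := hi' j; have := e j; lia.
  exists (Ordinal l1) => j; rewrite hka -[j == _]/(j == i :> nat).
  by have := hi j; have := hi' j; have := e j; lia.
have e := de _ c1 c2; case/covP: c1 => i hi; case/covP: c2 => i' hi'.
have ii : i != i'.
  by apply/eqP => ii; case/eqP: ne; apply: part_inj => k; rewrite hi hi' ii.
have [la hla] : exists la : intpart n.+2, part la =1 (fun j => maxn (part mu j) (part nu j)).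
  apply: part_exists => //; have := smm n.+3.
  have -> : (\sum_(j < n.+3) minn (part mu j) (part nu j) = n)%N.
    by rewrite -[RHS](sum_part x (leqW (leqW (leqnSn n)))); apply: eq_bigr => j _; rewrite e.
  have le3 : (n.+1 <= n.+3)%N by lia.
  by rewrite !(sum_part _ le3); lia.
exists la; rewrite inE; apply/andP; split; apply/covP.
  exists (widen_ord (leqnSn _) i') => j /=; rewrite hla hi hi'.
  have : (i == i' :> nat) = false by rewrite val_eqE (negbTE ii).
  by case: eqP; case: eqP; case: eqP; lia.
exists (widen_ord (leqnSn _) i) => j /=; rewrite hla hi hi'.
have : (i == i' :> nat) = false by rewrite val_eqE (negbTE ii).
by case: eqP; case: eqP; case: eqP; lia.
Qed.

(** * Removing the last letter of a tableau *)

Local Notation raw n := {ffun 'I_n -> 'I_n * 'I_n}.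
Local Notation up := (lift ord_max).

Lemma mem_diagram n (la : intpart n) (x : 'I_n * 'I_n) :
  (x \in diagram la) = (x.2 < part la x.1)%N.
Proof. by rewrite inE part_ord. Qed.

Lemma box_inj n (x y : 'I_n * 'I_n) :
  x.1 = y.1 :> nat -> x.2 = y.2 :> nat -> x = y.
Proof. by case: x y => a b [c d] /= /val_inj -> /val_inj ->. Qed.

Lemma syt_box_exists n (la : intpart n) (T : syt la) (a b : nat) :
  (b < part la a)%N -> exists k : 'I_n, (T k).1 = a :> nat /\ (T k).2 = b :> nat.
Proof.
move=> h; have ha : (a < n)%N by rewrite ltnNge; apply/negP => h'; rewrite part_out in h.
have hb : (b < n)%N.
  by have := ltn_ord (la (Ordinal ha)); rewrite -part_ord /=; lia.
have : (Ordinal ha, Ordinal hb) \in diagram la by rewrite mem_diagram.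
by rewrite (YoungForm.syt_dom T) => /imsetP[k _ e]; exists k; rewrite -e.
Qed.

Lemma syt_box_inj n (la : intpart n) (T : syt la) (k l : 'I_n) :
  (T k).1 = (T l).1 :> nat -> (T k).2 = (T l).2 :> nat -> k = l.
Proof.
by move=> h1 h2; apply: (@YoungForm.syt_inj _ _ T); apply: box_inj.
Qed.

(** The box just above holds a smaller entry, so induction on the entry applies. Together with the
    bound on columns, this makes the boxes of the first letters fit into the smaller index type of
    [restrict]. *)
Lemma syt_row_le n (la : intpart n) (T : syt la) (k : 'I_n) : ((T k).1 <= k)%N.
Proof.
have [m] := ubnP (k : nat); elim: m => // m IH in k *; rewrite ltnS => km.
case E : (T k).1 => [[|a] ha] //=; have Ev : (T k).1 = a.+1 :> nat by rewrite E.
have := YoungForm.syt_in T k; rewrite mem_diagram Ev => h.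
have [l [l1 l2]] := syt_box_exists T (leq_trans h (part_anti la a)).
have lk : (l < k)%N.
  by apply: (@YoungForm.syt_col _ _ T); [apply/val_inj | rewrite l1 Ev].
by have := IH l (leq_trans lk km); rewrite l1 => /leq_ltn_trans; apply.
Qed.

Lemma syt_col_le n (la : intpart n) (T : syt la) (k : 'I_n) : ((T k).2 <= k)%N.
Proof.
have [m] := ubnP (k : nat); elim: m => // m IH in k *; rewrite ltnS => km.
case E : (T k).2 => [[|a] ha] //=; have Ev : (T k).2 = a.+1 :> nat by rewrite E.
have := YoungForm.syt_in T k; rewrite mem_diagram Ev => h.
have [l [l1 l2]] := syt_box_exists T (ltnW h).
have lk : (l < k)%N.
  by apply: (@YoungForm.syt_row _ _ T); [apply/val_inj | rewrite l2 Ev].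
by have := IH l (leq_trans lk km); rewrite l2 => /leq_ltn_trans; apply.
Qed.

Lemma bump_max n (k : 'I_n) : bump n k = k.
Proof. exact: lift_max. Qed.

Section Restrict.
Variable n : nat.
Implicit Types (mu : intpart n) (la : intpart n.+1).

(* The default value of [insubd] is never reached on standard tableaux. *)
Definition restrict (T : raw n.+1) : raw n :=
  [ffun k : 'I_n => (insubd k (val (T (up k)).1), insubd k (val (T (up k)).2))].

Definition extend (x : 'I_n.+1 * 'I_n.+1) (X : raw n) : raw n.+1 :=
  [ffun k => if unlift ord_max k is Some k' then (up (X k').1, up (X k').2) else x].

Lemma extend_up x X (k : 'I_n) : extend x X (up k) = (up (X k).1, up (X k).2).
Proof. by rewrite ffunE liftK. Qed.

Lemma extend_max x X : extend x X ord_max = x.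
Proof. by rewrite ffunE unlift_none. Qed.

Lemma restrict_row la (T : syt la) (k : 'I_n) :
  (restrict T k).1 = (T (up k)).1 :> nat.
Proof.
rewrite ffunE /= val_insubd.
by have := syt_row_le T (up k); rewrite lift_max => /leq_ltn_trans -> //.
Qed.

Lemma restrict_col la (T : syt la) (k : 'I_n) :
  (restrict T k).2 = (T (up k)).2 :> nat.
Proof.
rewrite ffunE /= val_insubd.
by have := syt_col_le T (up k); rewrite lift_max => /leq_ltn_trans -> //.
Qed.

Lemma extendK x : cancel (extend x) restrict.
Proof.
move=> X; apply/ffunP => k; rewrite ffunE extend_up /=.
by apply: box_inj; rewrite val_insubd /= bump_max ltn_ord.
Qed.

Lemma restrictK la (T : syt la) : extend (T ord_max) (restrict T) = T.
Proof.
apply/ffunP => k; case: (unliftP ord_max k) => [k' ->|->]; last by rewrite extend_max.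
rewrite extend_up; apply: box_inj.
  exact: etrans (bump_max _) (restrict_row T k').
exact: etrans (bump_max _) (restrict_col T k').
Qed.

(** A box to the right of the last letter, or below it, would hold a larger entry. The last letter
    therefore sits in a removable box. *)
Lemma syt_last la (T : syt la) : exists mu,
  [/\ covr (T ord_max).1 mu la, is_syt mu (restrict T) &
      (T ord_max).2 = part mu (T ord_max).1 :> nat].
Proof.
set i := (T ord_max).1; set c := (T ord_max).2.
have cin : (c < part la i)%N by have := YoungForm.syt_in T ord_max; rewrite mem_diagram.
have row_end : part la i = c.+1.
  apply/eqP; rewrite eqn_leq cin andbT leqNgt; apply/negP => /(syt_box_exists T)[k [k1 k2]].
  have : ((ord_max : 'I_n.+1) < k)%N.
    apply: (@YoungForm.syt_row _ _ T); first exact/val_inj.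
    by rewrite k2.
  by rewrite ltnNge -ltnS ltn_ord.
have col_end : (part la i.+1 <= c)%N.
  rewrite leqNgt; apply/negP => /(syt_box_exists T)[k [k1 k2]].
  have : ((ord_max : 'I_n.+1) < k)%N.
    apply: (@YoungForm.syt_col _ _ T); first exact/val_inj.
    by rewrite k1.
  by rewrite ltnNge -ltnS ltn_ord.
have [mu hmu] : exists mu, covr i mu la by apply: covr_down_exists; rewrite row_end.
have muE := covrP _ _ _ hmu.
have ci : c = part mu i :> nat by have := muE i; rewrite row_end eqxx; lia.
exists mu; split => //; apply/and4P; split.
- apply/injectiveP => k l e; apply: (@lift_inj _ ord_max); apply: (@syt_box_inj _ _ T).
    by rewrite -!restrict_row e.
  by rewrite -!restrict_col e.
- apply/eqP/setP => x; rewrite mem_diagram; apply/imsetP/idP => [[k _ ->]|h].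
    rewrite restrict_row restrict_col.
    have := YoungForm.syt_in T (up k); rewrite mem_diagram muE.
    case: eqP => [e|_]; last by rewrite addn0.
    rewrite addn1 ltnS leq_eqVlt => /predU1P[e2|//].
    have /eqP : up k = ord_max.
      by apply: (@syt_box_inj _ _ T); rewrite ?e // e2 -?ci e.
    by rewrite eq_sym (negbTE (neq_lift _ _)).
  have [k [k1 k2]] : exists k : 'I_n.+1, (T k).1 = x.1 :> nat /\ (T k).2 = x.2 :> nat.
    by apply: syt_box_exists; rewrite muE; apply: leq_trans h (leq_addr _ _).
  case: (unliftP ord_max k) k1 k2 => [k' ->|->] k1 k2.
    by exists k' => //; apply: box_inj; rewrite ?restrict_row ?restrict_col.
  by move: h; rewrite -k1 -k2 -/i -/c ci ltnn.
- apply/forallP => k; apply/forallP => l; apply/implyP => /andP[/eqP e lt].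
  have : (up k < up l)%N.
    apply: (@YoungForm.syt_row _ _ T); first by apply/val_inj; rewrite /= -!restrict_row e.
    by rewrite -!restrict_col.
  by rewrite !lift_max.
- apply/forallP => k; apply/forallP => l; apply/implyP => /andP[/eqP e lt].
  have : (up k < up l)%N.
    apply: (@YoungForm.syt_col _ _ T); first by apply/val_inj; rewrite /= -!restrict_col e.
    by rewrite -!restrict_row.
  by rewrite !lift_max.
Qed.

(** The box by which a cover of [mu] in row [i] exceeds [mu]. Its column is at most [n], so [inord]
    never takes its default value. *)
Definition last_box (i : 'I_n.+1) mu : 'I_n.+1 * 'I_n.+1 := (i, inord (part mu i)).

Lemma last_box_col i mu : (last_box i mu).2 = part mu i :> nat.
Proof.
rewrite /= inordK // ltnS; case: (ltnP i n) => h; last by rewrite part_out.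
by rewrite -[i : nat]/(val (Ordinal h)) part_ord -ltnS.
Qed.

Lemma extend_syt (i : 'I_n.+1) mu la (X : syt mu) : covr i mu la -> is_syt la (extend (last_box i mu) X).
Proof.
move=> hmu; have muE := covrP _ _ _ hmu.
have muX k : ((X k).2 < part mu (X k).1)%N.
  by have := YoungForm.syt_in X k; rewrite mem_diagram.
have laX k : ((X k).2 < part la (X k).1)%N by rewrite muE; have := muX k; lia.
have lb := last_box_col i mu; have lb1 : (last_box i mu).1 = i by [].
apply/and4P; split.
- apply/injectiveP => k l.
  case: (unliftP ord_max k) => [k' ->|->]; case: (unliftP ord_max l) => [l' ->|->] //;
    rewrite ?extend_up ?extend_max.
  + move=> e; congr up; apply: (@syt_box_inj _ _ X).
      by have := congr1 (fun x => nat_of_ord x.1) e; rewrite /= !bump_max.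
    by have := congr1 (fun x => nat_of_ord x.2) e; rewrite /= !bump_max.
  + move=> e; have := muX k'; have := lb; rewrite -e /= bump_max => ->.
    have -> : (X k').1 = i :> nat by rewrite -lb1 -e /= bump_max.
    by rewrite ltnn.
  + move=> e; have := muX l'; have := lb; rewrite e /= bump_max => ->.
    have -> : (X l').1 = i :> nat by rewrite -lb1 e /= bump_max.
    by rewrite ltnn.
- apply/eqP/setP => x; rewrite mem_diagram; apply/imsetP/idP => [[k _ ->]|].
    case: (unliftP ord_max k) => [k' ->|->]; rewrite ?extend_up ?extend_max.
      by rewrite /= !bump_max.
    by rewrite lb muE lb1 eqxx addn1.
  rewrite muE; have [h1 h2|h1 h2] := ltnP x.2 (part mu x.1).
    have [k [k1 k2]] := syt_box_exists X h1.
    by exists (up k) => //; rewrite extend_up; apply: box_inj; rewrite /= bump_max.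
  exists ord_max => //; rewrite extend_max; apply: box_inj.
    by move: h2; rewrite lb1; case: eqP => // _; rewrite addn0 ltnNge h1.
  move: h2; case: eqP => [e|_]; last by rewrite addn0 ltnNge h1.
  by rewrite addn1 ltnS lb -e => h2; apply/eqP; rewrite eqn_leq h2.
- apply/forallP => k; apply/forallP => l; apply/implyP => /andP[/eqP e].
  case: (unliftP ord_max k) e => [k' ->|->]; case: (unliftP ord_max l) => [l' ->|->];
    rewrite ?extend_up ?extend_max ?ltnn //.
  + by rewrite /= !bump_max => /lift_inj e lt; apply: (@YoungForm.syt_row _ _ X).
  + by rewrite lift_max.
  + rewrite lb lb1 /= bump_max => e lt; have := muX l'.
    have -> : (X l').1 = i :> nat by rewrite e /= bump_max.
    by rewrite ltnNge (ltnW lt).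
- apply/forallP => k; apply/forallP => l; apply/implyP => /andP[/eqP e].
  case: (unliftP ord_max k) e => [k' ->|->]; case: (unliftP ord_max l) => [l' ->|->];
    rewrite ?extend_up ?extend_max ?ltnn //.
  + by rewrite /= !bump_max => /lift_inj e lt; apply: (@YoungForm.syt_col _ _ X).
  + by rewrite lift_max.
  + rewrite lb1 => e; rewrite [X in (_ < X)%N -> _]/= bump_max => lt; have := muX l'.
    have -> : (X l').2 = part mu i :> nat by rewrite -lb e /= bump_max.
    by rewrite ltnNge (antitone_le (part_anti mu) (ltnW lt)).
Qed.

Section Sums.
Variable V : nmodType.

(** [extend] is a bijection from SYT(mu) onto the block of tableaux with the last letter in row [i].
    At most one [mu] occurs on the right; if there is none, the block is empty. *)
Lemma sum_syt_row (h : raw n.+1 -> V) (i : 'I_n.+1) la :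
  \sum_(T : syt la | (T ord_max).1 == i) h T =
  \sum_(mu | covr i mu la) \sum_(X : syt mu) h (extend (last_box i mu) X).
Proof.
have [/existsP[mu hmu]|nex] := boolP [exists mu, covr i mu la]; last first.
  rewrite !big_pred0 // => [mu|T]; first by move: nex; rewrite negb_exists => /forallP/(_ mu)/negbTE.
  apply/eqP => e; have [mu [hmu _ _]] := syt_last T.
  by case/existsP: nex; exists mu; rewrite -e.
rewrite (big_pred1 mu) => [|mu']; last first.
  by apply/idP/eqP => [/covr_down/(_ hmu)|->].
pose f (X : syt mu) : syt la := Syt (extend_syt X hmu).
rewrite -[RHS](big_imset (fun T : syt la => h T) (h := f) (A := predT)) /=; last first.
  by move=> X Y _ _ /(congr1 val) /= /(can_inj (extendK _)) /val_inj.
apply: eq_bigl => T; apply/eqP/imsetP => [e|[X _ ->]]; last by rewrite /= extend_max.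
have [mu' []] := syt_last T; rewrite e => hmu' stX c.
move: (mu') (covr_down hmu' hmu) stX c => _ -> stX c.
exists (Syt stX) => //; apply/val_inj => /=; rewrite -[LHS](restrictK T); congr extend.
by apply: box_inj; rewrite ?e // c last_box_col.
Qed.

Lemma sum_syt_restrict_row (h : raw n -> V) (i : 'I_n.+1) la :
  \sum_(T : syt la | (T ord_max).1 == i) h (restrict T) =
  \sum_(mu | covr i mu la) \sum_(X : syt mu) h X.
Proof.
rewrite (sum_syt_row (fun T => h (restrict T))).
by apply: eq_bigr => mu _; apply: eq_bigr => X _; rewrite extendK.
Qed.

End Sums.

Lemma sum_syt_restrict (V : zmodType) (h : raw n -> V) la :
  \sum_(T : syt la) h (restrict T) = \sum_(mu | cov mu la) \sum_(X : syt mu) h X.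
Proof.
rewrite big_cov_down (partition_big (fun T : syt la => (T ord_max).1) predT) //=.
by apply: eq_bigr => i _; rewrite sum_syt_restrict_row.
Qed.

End Restrict.

Lemma syt0 (la : intpart 0) : #|{: syt la}| = 1%N.
Proof.
have st : is_syt la [ffun k => (k, k)].
  apply/and4P; split.
  - by apply/injectiveP => -[].
  - by apply/eqP/setP => -[[]].
  - by apply/forallP => -[].
  - by apply/forallP => -[].
by apply/eqP/fintype1P; exists (Syt st) => T; apply/val_inj/ffunP => -[].
Qed.

Lemma intpart0_unique (la mu : intpart 0) : la = mu.
Proof. by apply: part_inj => i; rewrite !part_out. Qed.

Lemma intpart0_exists : exists la : intpart 0, True.
Proof.
have [//||la _] := @part_exists 0 (fun=> 0%N); last by exists la.
by rewrite big1.
Qed.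

(** * The up and down operators *)

Section Graded.
Variable R : realFieldType.

(** A function on partitions of every size. On these, [raise] is the up operator U, [lower] is the
    down operator D, and both can be iterated without casts between sizes. *)
Definition gvec := forall n, intpart n -> R.
Implicit Types g h : gvec.

Definition raise g : gvec := fun n =>
  if n is n'.+1 then fun la => \sum_(mu | cov mu la) g n' mu else fun=> 0.

Definition lower g : gvec := fun n mu => \sum_(la | cov mu la) g n.+1 la.

Definition ip n g h : R := \sum_la g n la * h n la.

Lemma ipC n g h : ip n g h = ip n h g.
Proof. by apply: eq_bigr => la _; rewrite mulrC. Qed.

Lemma ip_raise n g h : ip n.+1 (raise g) h = ip n g (lower h).
Proof.
rewrite /ip /raise /lower.
transitivity (\sum_(la : intpart n.+1) \sum_(mu | cov mu la) g n mu * h n.+1 la).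
  by apply: eq_bigr => la _; rewrite mulr_suml.
rewrite (exchange_big_dep predT) //=.
by apply: eq_bigr => mu _; rewrite mulr_sumr.
Qed.

(** The relation DU - UD = 1. Off the diagonal, common covers and commonly covered partitions are
    equally many; on the diagonal, there is one more cover than covered partition. *)
Lemma lower_raise g n (mu : intpart n) :
  lower (raise g) mu = raise (lower g) mu + g n mu.
Proof.
case: n mu => [|n] mu; rewrite /lower /raise.
  rewrite add0r (eq_bigr (fun=> g 0%N mu)) => [|la mula].
    by rewrite sumr_const card_cov_up /corners big_ord0.
  by rewrite (big_pred1 mu) // => nu; rewrite (intpart0_unique nu mu) mula /= eqxx.
rewrite (exchange_big_dep predT) //= [X in _ = X + _](exchange_big_dep predT) //=.
rewrite (bigD1 mu) //= [X in _ = X + _](bigD1 mu) //= addrAC; congr (_ + _).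
  rewrite !sumr_const -mulrSr; congr (_ *+ _).
  transitivity #|[pred la | cov mu la]|; first by apply: eq_card => la; rewrite unfold_in andbb.
  rewrite card_cov_up -card_cov_down; congr _.+1.
  by apply: eq_card => ka; rewrite unfold_in [RHS]unfold_in /= andbb.
by apply: eq_bigr => nu ne; rewrite !sumr_const card_cov_comm // eq_sym.
Qed.

Lemma raise_ext g h n (la : intpart n) :
  (forall m (mu : intpart m), g m mu = h m mu) -> raise g la = raise h la.
Proof. by move=> gh; case: n la => //= n la; apply: eq_bigr. Qed.

Lemma raise_lin g h (c : R) n (la : intpart n) :
  raise (fun m mu => g m mu + c * h m mu) la = raise g la + c * raise h la.
Proof.
case: n la => [|n] la /=; first by rewrite mulr0 addr0.
by rewrite big_split mulr_sumr.
Qed.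

Definition raiseX M g : gvec := iter M raise g.

(** The relation D U^M = U^M D + M U^(M-1), by moving D past one U at a time. For [M = 0] the
    truncated predecessor is multiplied by 0. *)
Lemma lower_raiseX M g n (mu : intpart n) :
  lower (raiseX M g) mu = raiseX M (lower g) mu + M%:R * raiseX M.-1 g mu.
Proof.
elim: M n mu => [|M IH] n mu; first by rewrite mul0r addr0.
rewrite [LHS]lower_raise (raise_ext _ IH) raise_lin -[raise (raiseX M _) _]/(raiseX M.+1 _ _).
rewrite -addrA; congr (_ + _); case: M {IH} => [|M] /=; first by rewrite mul0r add0r mul1r.
by rewrite -[raise (raiseX M g) mu]/(raiseX M.+1 g mu) -[in RHS]natr1 mulrDl mul1r.
Qed.

Lemma raiseX_eq0 l g : (forall mu, g l mu = 0) -> forall M (la : intpart (M + l)), raiseX M g la = 0.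
Proof. by move=> g0; elim=> //= M IH la; rewrite big1 // => mu _; apply: IH. Qed.

Lemma raiseX_orbit r g :
  (forall n (la : intpart n.+1), (r <= n)%N -> g n.+1 la = raise g la) ->
  forall M (la : intpart (M + r)), g (M + r)%N la = raiseX M g la.
Proof.
move=> H; elim=> // M IH la; rewrite [LHS]H ?leq_addl //=.
by apply: eq_bigr => mu _; apply: IH.
Qed.

(** Divided by [M!], each recurrence becomes a summation. Summing [e] costs one power of [M.+1]. In
    the recurrence for [a], the term [b M] is divided by [(M.+1)!], which gains back the power that
    the second summation costs. *)
Lemma rec_fact_bound (a b e : nat -> R) (C : R) s : 0 <= C -> 0 <= a 0%N ->
  (forall M, a M.+1 = b M + M.+1%:R * a M) -> b 0%N = e 0%N ->
  (forall M, b M.+1 = e M.+1 + M.+1%:R * b M) ->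
  (forall M, e M <= C * M`!%:R * M.+1%:R ^+ s) ->
  exists2 C', 0 <= C' & forall M, a M <= C' * M`!%:R * M.+1%:R ^+ s.+1.
Proof.
move=> C0 a0 ha b0 hb he.
have monoX M : M.+1%:R ^+ s <= M.+2%:R ^+ s :> R.
  by apply: lerXn2r; rewrite ?nnegrE ?ler0n // ler_nat.
have leb M : b M <= C * M`!%:R * M.+1%:R ^+ s.+1.
  elim: M => [|M IH]; first by rewrite b0; apply: le_trans (he 0%N) _; rewrite !expr1n.
  rewrite hb; apply: le_trans (lerD (he _) (ler_wpM2l (ler0n _ _) IH)) _.
  rewrite factS natrM !exprS -[M.+2%:R]natr1; move: (monoX M) (ler0n R M`!) (ler0n R M.+1).
  rewrite -[M.+2%:R]natr1.
  move: (M.+1%:R) (M`!%:R) (_ ^+ s) ((_ + 1) ^+ s) => x f y z yz f0 x0.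
  rewrite -subr_ge0.
  have -> : C * (x * f) * ((x + 1) * z) - (C * (x * f) * z + x * (C * f * (x * y))) =
    C * x * f * x * (z - y) by ring.
  by rewrite !mulr_ge0 ?subr_ge0.
exists (a 0%N + C) => [|M]; first exact: addr_ge0.
elim: M => [|M IH]; first by rewrite expr1n !mulr1 lerDl.
rewrite ha; apply: le_trans (lerD (leb _) (ler_wpM2l (ler0n _ _) IH)) _.
rewrite factS natrM !exprS -[M.+2%:R]natr1; move: (monoX M) (ler0n R M`!) (ler0n R M.+1).
have z0 : 0 <= M.+1%:R ^+ s :> R by rewrite exprn_ge0.
rewrite -[M.+2%:R]natr1; move: z0.
move: (M.+1%:R) (M`!%:R) (_ ^+ s) ((_ + 1) ^+ s) => x f y z y0 yz f0 x0.
rewrite -subr_ge0; set A := a 0%N in a0 *.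
have -> : (A + C) * (x * f) * ((x + 1) * z) - (C * f * (x * y) + x * ((A + C) * f * (x * y))) =
    (A + C) * x * f * (x + 1) * (z - y) + A * x * f * y by ring.
by apply: addr_ge0; rewrite !mulr_ge0 ?subr_ge0 ?addr_ge0.
Qed.

Definition dimv : gvec := fun n la => (dim_part la)%:R.

Lemma dim_restrict n (la : intpart n.+1) :
  (dim_part la)%:R = \sum_(mu | cov mu la) (dim_part mu)%:R :> R.
Proof.
have := sum_syt_restrict (fun=> 1 : R) la.
rewrite sumr_const => ->; apply: eq_bigr => mu _; by rewrite sumr_const.
Qed.

Lemma dimv_raise n (la : intpart n.+1) : dimv la = raise dimv la.
Proof. exact: dim_restrict. Qed.

(** Since dim is fixed by U, the relation DU = UD + 1 adds 1 to the eigenvalue of D at each size. *)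
Lemma lower_dimv n (mu : intpart n) : lower dimv mu = n.+1%:R * dimv mu.
Proof.
have E m (nu : intpart m) : lower dimv nu = lower (raise dimv) nu.
  by apply: eq_bigr => la _; apply: dimv_raise.
elim: n mu => [|n IH] mu; rewrite E lower_raise.
  by rewrite add0r mul1r.
rewrite /raise (eq_bigr _ (fun nu _ => IH nu)) -mulr_sumr -[\sum_(i | _) _]dimv_raise.
by rewrite -[n.+2%:R]natr1 mulrDl mul1r.
Qed.

Lemma sum_dim2 n : ip n dimv dimv = n`!%:R.
Proof.
elim: n => [|n IH].
  have [la _] := intpart0_exists.
  rewrite /ip (big_pred1 la) => [|mu]; last by rewrite (intpart0_unique mu la) /= eqxx.
  by rewrite /dimv /dim_part syt0 mulr1.
transitivity (ip n.+1 (raise dimv) dimv).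
  by apply: eq_bigr => la _; rewrite dimv_raise.
rewrite ip_raise factS natrM -IH mulr_sumr; apply: eq_bigr => mu _.
by rewrite lower_dimv mulrCA.
Qed.

(** * Norms of the iterates of the up operator *)

Section Orbit.
Variables (l : nat) (g : gvec).

(** These are |U^M g|^2, the cross term of U^M g with U^(M+1) D g, and |U^M D g|^2. Each recurrence
    below moves one U across the inner product and commutes the resulting D past the other U's. *)
Let a M := ip (M + l.+1) (raiseX M g) (raiseX M g).
Let b M := ip (M + l.+1) (raiseX M g) (raiseX M.+1 (lower g)).
Let e M := ip (M + l) (raiseX M (lower g)) (raiseX M (lower g)).

Lemma orbit_recS M : a M.+1 = b M + M.+1%:R * a M.
Proof.
rewrite /a addSn [LHS]ip_raise /b /ip [X in _ = _ + X]mulr_sumr -big_split; apply: eq_bigr => la _ /=.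
rewrite -[raise (raiseX M g)]/(raiseX M.+1 g) lower_raiseX mulrDr; congr (_ + _).
by rewrite mulrCA.
Qed.

Lemma orbit_rec0 : b 0%N = e 0%N.
Proof. by rewrite /b ipC [LHS]ip_raise. Qed.

Lemma orbit_cross M : b M.+1 = e M.+1 + M.+1%:R * b M.
Proof.
have -> : b M = ip (M.+1 + l) (raiseX M.+1 (lower g)) (raiseX M g).
  by rewrite /b ipC addSnnS.
rewrite /b ipC addnS [LHS]ip_raise /e /ip [X in _ = _ + X]mulr_sumr -big_split.
apply: eq_bigr => la _.
by rewrite lower_raiseX mulrDr; congr (_ + _); apply: mulrCA.
Qed.

End Orbit.

Lemma ip_ge0 n g : 0 <= ip n g g.
Proof. by apply: sumr_ge0 => la _; rewrite -expr2 sqr_ge0. Qed.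

(** Induction on the size where [g] lives: [a] is controlled through [b] by [e], which is the same
    quantity for [lower g]. Orthogonality to dim is inherited, as the product of D g with dim is
    that of g with U dim = dim. *)
Lemma raiseX_norm_bound l g : ip l.+1 g dimv = 0 ->
  exists2 C, 0 <= C & forall M,
    ip (M + l.+1) (raiseX M g) (raiseX M g) <= C * M`!%:R * M.+1%:R ^+ l.
Proof.
elim: l g => [|l IH] g g0.
  (* Size 0 has a single partition, of dimension 1, so orthogonality to dim means vanishing. *)
  have low0 mu : lower g (mu : intpart 0) = 0.
    have : ip 0 (lower g) dimv = 0.
      rewrite ipC -ip_raise ipC -[RHS]g0.
      by apply: eq_bigr => la _; rewrite dimv_raise.
    rewrite /ip (big_pred1 mu) => [|nu]; last by rewrite (intpart0_unique nu mu) /= eqxx.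
    by rewrite /dimv /dim_part syt0 mulr1.
  have e0 M : ip (M + 0) (raiseX M (lower g)) (raiseX M (lower g)) = 0.
    by apply: big1 => la _; rewrite (raiseX_eq0 low0) mul0r.
  have b0 M : ip (M + 1) (raiseX M g) (raiseX M.+1 (lower g)) = 0.
    elim: M => [|M IH]; first by rewrite orbit_rec0 e0.
    by rewrite orbit_cross e0 IH mulr0 addr0.
  exists (ip 1 g g) => [|M]; first exact: ip_ge0.
  elim: M => [|M IH]; first by rewrite !mulr1.
  rewrite expr0 mulr1 in IH; rewrite orbit_recS b0 add0r factS natrM expr0 mulr1.
  by rewrite mulrCA ler_wpM2l.
have [|C C0 hC] := IH (lower g).
  rewrite ipC -ip_raise ipC -[RHS]g0.
  by apply: eq_bigr => la _; rewrite dimv_raise.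
exact: (rec_fact_bound C0 (ip_ge0 l.+2 g) (@orbit_recS l.+1 g) (orbit_rec0 _ _) (@orbit_cross _ _) hC).
Qed.

Lemma fact_pow_le M l : (M`! * M.+1 ^ l <= (M + l)`!)%N.
Proof.
elim: l => [|l IH]; first by rewrite addn0 muln1.
by rewrite addnS factS expnSr mulnA mulnC leq_mul // ltnS leq_addr.
Qed.

(** The norm bound has exponent [r - 1], so one more factor [M.+1] still leaves [M! * (M+1)^r],
    which is at most [(M+r)!]. For [r = 0] orthogonality makes the whole orbit vanish. *)
Lemma orbit_norm_bound r g :
  (forall n (la : intpart n.+1), (r <= n)%N -> g n.+1 la = raise g la) ->
  ip r g dimv = 0 ->
  exists2 C, 0 <= C & forall M, ip (M + r) g g * M.+1%:R <= C * (M + r)`!%:R.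
Proof.
move=> /raiseX_orbit orb g0.
have E M : ip (M + r) g g = ip (M + r) (raiseX M g) (raiseX M g).
  by apply: eq_bigr => la _; rewrite !orb.
case: r g0 orb E => [|l] g0 orb E.
  exists 0 => // M; rewrite mul0r E /ip big1 ?mul0r // => la _.
  rewrite (raiseX_eq0 (l := 0)) ?mul0r // => mu.
  move: g0; rewrite /ip (big_pred1 mu) => [|nu]; last by rewrite (intpart0_unique nu mu) /= eqxx.
  by rewrite /dimv /dim_part syt0 mulr1.
have [C C0 hC] := raiseX_norm_bound g0; exists C => // M; rewrite E.
apply: le_trans (ler_wpM2r (ler0n _ _) (hC M)) _.
rewrite -!mulrA -exprSr ler_wpM2l // -natrX -natrM ler_nat.
exact: fact_pow_le.
Qed.

End Graded.

(** * Last letter order and Young's orthogonal form *)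

Section LastLetterOrder.
Variables (n : nat) (la : intpart n).
Implicit Types T S V : syt la.

(** Take the first letter whose columns differ. In the tableau where it lies further right, its box
    in the other tableau is filled by a smaller letter, on which both agree. Totality of the last
    letter order rests on this. *)
Lemma syt_rows_inj T S : (forall k, (T k).1 = (S k).1) -> T = S.
Proof.
move=> h; apply/val_inj/ffunP => k /=.
have [m] := ubnP (k : nat); elim: m => // m IH in k *; rewrite ltnS => km.
apply: box_inj; first by rewrite h.
have aux (X Y : syt la) : (forall k, (X k).1 = (Y k).1) ->
    (forall l : 'I_n, (l < k)%N -> X l = Y l) -> ((Y k).2 <= (X k).2)%N.
  move=> e IHl; rewrite leqNgt; apply/negP => lt.
  have [l [l1 l2]] : exists l, (Y l).1 = (Y k).1 :> nat /\ (Y l).2 = (X k).2 :> nat.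
    apply: syt_box_exists; apply: ltn_trans lt _.
    by have := YoungForm.syt_in Y k; rewrite mem_diagram.
  have lk : (l < k)%N.
    by apply: (@YoungForm.syt_row _ _ Y); [exact/val_inj | rewrite l2].
  have e' : l = k by apply: (@syt_box_inj _ _ X); rewrite ?e // IHl.
  by rewrite e' ltnn in lk.
apply/eqP; rewrite eqn_leq !aux // => l lk; last by rewrite IH // (leq_trans lk).
by rewrite -IH // (leq_trans lk).
Qed.

Lemma llo_ltP T S : reflect
  (exists2 k : 'I_n, ((S k).1 < (T k).1)%N & forall l : 'I_n, (k < l)%N -> (T l).1 = (S l).1)
  (llo_lt T S).
Proof.
apply: (iffP existsP) => [[k /andP[h /forallP h']]|[k h h']]; exists k => //.
  by move=> l kl; apply/eqP; apply: (implyP (h' l)).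
by rewrite h; apply/forallP => l; apply/implyP => /h' ->.
Qed.

Lemma llo_total : total (@llo_le n la).
Proof.
move=> T S; rewrite /llo_le; have [->//|ne] := eqVneq T S.
have [k0 hk0] : exists k, (T k).1 != (S k).1.
  apply/existsP; apply: contraNT ne; rewrite negb_exists => /forallP h.
  by apply/eqP/syt_rows_inj => k; apply/eqP; rewrite -[_ == _]negbK.
have [k hk kmax] := @arg_maxnP _ k0 (fun k => (T k).1 != (S k).1) (fun k => k : nat) hk0.
have eql (l : 'I_n) : (k < l)%N -> (T l).1 = (S l).1.
  by move=> kl; apply/eqP; apply: contraTT kl => /kmax; rewrite -leqNgt.
rewrite /=; case: (ltngtP (T k).1 (S k).1) => [lt|lt|/val_inj e].
- apply/orP; right; apply/llo_ltP; exists k => // l kl.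
  by rewrite eql.
- by apply/orP; left; apply/llo_ltP; exists k.
by rewrite e eqxx in hk.
Qed.

Lemma llo_lt_trans : transitive (@llo_lt n la).
Proof.
move=> S T V /llo_ltP[k h1 e1] /llo_ltP[k' h2 e2]; apply/llo_ltP.
case: (ltngtP k k') => [lt|lt|/val_inj ek].
- exists k' => [|l kl]; first by rewrite e1.
  by rewrite e1 ?e2 //; apply: ltn_trans kl.
- exists k => [|l kl]; first by rewrite -e2.
  by rewrite e1 // e2 //; apply: ltn_trans kl.
by subst k'; exists k => [|l kl]; [apply: ltn_trans h1 | rewrite e1 ?e2].
Qed.

Lemma llo_le_trans : transitive (@llo_le n la).
Proof.
move=> S T V /orP[/eqP -> //|h] /orP[/eqP <-|h']; rewrite /llo_le ?h ?orbT //.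
by rewrite (llo_lt_trans h h') orbT.
Qed.

Lemma tab_mono (a b : 'I_(dim_part la)) : (a <= b)%N -> llo_le (tab a) (tab b).
Proof.
move=> ab; rewrite /tab !(tnth_nth (tab a)).
apply: (sorted_leq_nth llo_le_trans) => //; last 2 first.
- by rewrite inE size_tuple.
- by rewrite inE size_tuple.
- by move=> T; rewrite /llo_le eqxx.
exact: sort_sorted llo_total _.
Qed.

End LastLetterOrder.

(** If the last letter changes row, it is the letter that decides the comparison. Blocks are thus
    consecutive, with the lowest row first. *)
Lemma tab_last_row n (la : intpart n.+1) (a b : 'I_(dim_part la)) :
  (a <= b)%N -> ((tab b ord_max).1 <= (tab a ord_max).1)%N.
Proof.
move=> /tab_mono /orP[/eqP -> //|/llo_ltP[k lt e]].
have [->|ne] := eqVneq ord_max k; first exact: ltnW.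
rewrite e // ltn_neqAle -ltnS ltn_ord andbT.
by apply: contra_neq ne => /val_inj ->.
Qed.

Lemma big_tab (V : nmodType) n (la : intpart n) (f : syt la -> V) (P : pred (syt la)) :
  \sum_(a : 'I_(dim_part la) | P (tab a)) f (tab a) = \sum_(T | P T) f T.
Proof.
rewrite [RHS](reindex (@tab n la)) //; apply: onW_bij.
by apply: inj_card_bij (@YoungForm.tab_inj n la) _; rewrite card_ord.
Qed.

(** Adjacent transpositions generate the group; the measure [YoungForm.mu] drops when a descent is
    removed. *)
Lemma adjacent_ind n (P : 'S_n -> Prop) : P 1%g ->
  (forall (s : 'S_n) (i j : 'I_n), j = i.+1 :> nat -> P s -> P (tperm i j * s)%g) ->
  forall s, P s.
Proof.
move=> P1 PM s.
have [m] := ubnP (YoungForm.mu s); elim: m => // m IH in s *; rewrite ltnS => hm.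
have [/existsP[[i j] d]|nd] := boolP [exists p, YoungForm.desc s p]; last first.
  have -> : s = 1%g; last exact: P1.
  by apply: YoungForm.nodesc_id => p; apply: contraNN nd => d; apply/existsP; exists p.
rewrite -[s](mulKVg (tperm i j)) tpermV; apply: PM; first exact: YoungForm.desc_adj d.
by apply: IH; apply: leq_trans hm; apply: YoungForm.mu_swap.
Qed.

(** * The representation acting on functions of tableaux *)

Section Action.
Variable R : rcfType.

(** The function [w] lives on all fillings, standard or not, so that one [w] serves several shapes
    and entries can be swapped without a proof of standardness. *)
Definition act n (la : intpart n) (s : 'S_n) (w : raw n -> R) (a : 'I_(dim_part la)) : R :=
  \sum_b young_rep R la s a b * w (tab b).

Section ActFacts.
Variables (n : nat) (la : intpart n).

Lemma act_agree (s : 'S_n) (w w' : raw n -> R) (a : 'I_(dim_part la)) :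
  (forall X : syt la, w X = w' X) -> act s w a = act s w' a.
Proof. by move=> h; apply: eq_bigr => b _; rewrite h. Qed.

Lemma act1 w (a : 'I_(dim_part la)) : act 1%g w a = w (tab a).
Proof.
rewrite /act; have [-> _ _] := young_repP R la.
rewrite (bigD1 a) //= mxE eqxx mul1r big1 ?addr0 // => b ne.
by rewrite mxE eq_sym (negbTE ne) mul0r.
Qed.

Lemma young_gen_act (i j : 'I_n) (w : raw n -> R) (a : 'I_(dim_part la)) :
  j = i.+1 :> nat ->
  \sum_b young_gen R la i j a b * w (tab b) = YoungForm.rawop i j w (tab a).
Proof.
move=> ij; pose v (b : 'I_(dim_part la)) := w (tab b).
rewrite -[LHS]/(YoungForm.genop i j v a) -YoungForm.ext_tab.
rewrite (YoungForm.ext_genop _ ij) ?syt_boxP //.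
apply: (YoungForm.rawop_agree ij _ (syt_boxP _)) => X stX.
have [b e] := YoungForm.tab_surj (Syt stX).
by rewrite -[X]/(syt_box (Syt stX)) -e YoungForm.ext_tab.
Qed.

Lemma act_step (i j : 'I_n) s w (a : 'I_(dim_part la)) : j = i.+1 :> nat ->
  act (tperm i j * s)%g w a = act s (YoungForm.rawop i j w) a.
Proof.
move=> ij; rewrite /act; have [_ -> repT] := young_repP R la.
under eq_bigr do rewrite mxE mulr_suml.
rewrite exchange_big /=; apply: eq_bigr => c _.
rewrite -young_gen_act // mulr_sumr -repT //.
by apply: eq_bigr => b _; rewrite mulrA.
Qed.

(** Exchanging the two entries changes the sign of the content difference, and the off-diagonal
    coefficient depends only on its square. *)
Lemma young_gen_sym (i j : 'I_n) : (young_gen R la i j)^T = young_gen R la i j.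
Proof.
apply/matrixP => a b; rewrite !mxE /=.
have [->//|ne] := eqVneq (tab b) (tab a).
have -> : (syt_box (tab a) == swap_entries i j (tab b)) =
          (syt_box (tab b) == swap_entries i j (tab a)).
  by apply/eqP/eqP => ->; rewrite YoungForm.swap_entriesK.
case: eqP => // e; congr (Num.sqrt (1 - _^-1)).
rewrite -[LHS]/(YoungForm.rdist R (tab b) i j ^+ 2) -[RHS]/(YoungForm.rdist R (tab a) i j ^+ 2).
by rewrite e YoungForm.rdist_sw tpermL tpermR YoungForm.rdistN sqrrN.
Qed.

Lemma young_rep_orth s : (young_rep R la s)^T *m young_rep R la s = 1%:M.
Proof.
have [rep1 repM repT] := young_repP R la.
apply: mulmx1C; elim/adjacent_ind: s => [|s i j ij IH]; first by rewrite rep1 trmx1 mulmx1.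
rewrite repM trmx_mul repT // young_gen_sym mulmxA -(mulmxA (young_rep R la s)).
by rewrite YoungForm.young_gen_invol // mulmx1.
Qed.

(** Each product is at most half the sum of the two squares, and orthogonality gives the image of
    [v] the same norm as [v]. *)
Lemma young_rep_quad_bound s (v : 'I_(dim_part la) -> R) :
  `|\sum_a v a * \sum_b young_rep R la s a b * v b| <= \sum_a v a ^+ 2.
Proof.
pose x : 'cV_(dim_part la) := \col_b v b; pose y := young_rep R la s *m x.
have yE a : \sum_b young_rep R la s a b * v b = y a 0.
  by rewrite mxE; apply: eq_bigr => b _; rewrite mxE.
have ny : \sum_a y a 0 ^+ 2 = \sum_a v a ^+ 2.
  have : (y^T *m y) 0 0 = (x^T *m x) 0 0.
    by rewrite trmx_mul mulmxA -(mulmxA x^T) young_rep_orth mulmx1.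
  rewrite !mxE => e; transitivity (\sum_j y^T 0 j * y j 0).
    by apply: eq_bigr => a _; rewrite [y^T _ _]mxE expr2.
  by rewrite e; apply: eq_bigr => a _; rewrite !mxE expr2.
apply: le_trans (ler_norm_sum _ _ _) _.
apply: le_trans (_ : \sum_a (v a ^+ 2 + y a 0 ^+ 2) / 2%:R <= _).
  apply: ler_sum => a _; rewrite yE ler_norml.
  have := sqr_ge0 (v a - y a 0); have := sqr_ge0 (v a + y a 0) => h1 h2; apply/andP; split; nra.
by rewrite -mulr_suml big_split /= ny; lra.
Qed.

End ActFacts.

Definition lift_max_perm n (s : 'S_n) : 'S_n.+1 := lift_perm ord_max ord_max s.

(** * Permutations fixing the last letter *)

Section RestrictAction.
Variables (n : nat) (la : intpart n.+1).

Lemma tperm_up (i j k : 'I_n) : tperm (up i) (up j) (up k) = up (tperm i j k).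
Proof.
by case: tpermP => [/lift_inj ->|/lift_inj ->|h h'];
  rewrite ?tpermL ?tpermR // tpermD //; apply/eqP => e; [apply: h | apply: h']; rewrite e.
Qed.

Lemma tperm_max (i j : 'I_n) : tperm (up i) (up j) ord_max = ord_max.
Proof. by rewrite tpermD // eq_sym neq_lift. Qed.

Lemma lift_max_perm1 : lift_max_perm 1 = 1%g :> 'S_n.+1.
Proof. exact: lift_perm1. Qed.

Lemma lift_max_perm_step (i j : 'I_n) (s : 'S_n) :
  lift_max_perm (tperm i j * s) = (tperm (up i) (up j) * lift_max_perm s)%g.
Proof.
apply/permP => k; rewrite permM; case: (unliftP ord_max k) => [k' ->|->].
  by rewrite tperm_up !lift_perm_lift permM.
by rewrite tperm_max !lift_perm_id.
Qed.

Lemma up_adj (i j : 'I_n) : j = i.+1 :> nat -> up j = (up i).+1 :> nat.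
Proof. by rewrite !lift_max. Qed.

(** Adjacent transpositions of the other letters leave the box of the last letter in place. Hence
    the matrix is block diagonal for the blocks given by that box. *)
Lemma act_last_box (g : 'I_n.+1 * 'I_n.+1 -> R) (s : 'S_n) (w : raw n.+1 -> R)
    (a : 'I_(dim_part la)) :
  act (lift_max_perm s) (fun X => g (X ord_max) * w X) a =
  g (tab a ord_max) * act (lift_max_perm s) w a.
Proof.
elim/adjacent_ind: s w => [|s i j ij IH] w; first by rewrite lift_max_perm1 !act1.
have uij := up_adj ij; rewrite lift_max_perm_step !act_step // -IH; apply: act_agree => X.
rewrite /YoungForm.rawop /swap_entries ffunE tperm_max mulrDr.
by rewrite mulrCA; congr (_ + _); rewrite mulrCA.
Qed.

Lemma rdist_restrict (T : syt la) (i j : 'I_n) :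
  YoungForm.rdist R (restrict T) i j = YoungForm.rdist R T (up i) (up j).
Proof. by rewrite /YoungForm.rdist /box_content !restrict_row !restrict_col. Qed.

Lemma restrict_swap (T : syt la) (i j : 'I_n) :
  restrict (swap_entries (up i) (up j) T) = swap_entries i j (restrict T).
Proof.
apply/ffunP => k; rewrite [RHS]ffunE; apply: box_inj.
  rewrite restrict_row [in LHS]ffunE /= val_insubd ffunE tperm_up.
  by rewrite -[val _]/(nat_of_ord _) -restrict_row ltn_ord.
rewrite restrict_col [in LHS]ffunE /= val_insubd ffunE tperm_up.
by rewrite -[val _]/(nat_of_ord _) -restrict_col ltn_ord.
Qed.

(** The branching rule: the generators involved only see contents and swaps of the first [n]
    letters, which [restrict] preserves. A diagonal block is thus the representation of the smaller
    shape. *)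
Lemma act_restrict (mu : intpart n) (s : 'S_n) (w : raw n -> R)
    (a : 'I_(dim_part la)) (c : 'I_(dim_part mu)) :
  restrict (tab a) = tab c ->
  act (lift_max_perm s) (fun X => w (restrict X)) a = act s w c.
Proof.
move=> e; elim/adjacent_ind: s w => [|s i j ij IH] w.
  by rewrite lift_max_perm1 !act1 e.
have uij := up_adj ij; rewrite lift_max_perm_step !act_step // -IH; apply: act_agree => X.
by rewrite /YoungForm.rawop rdist_restrict restrict_swap.
Qed.

End RestrictAction.

Definition rowsum n (la : intpart n) (s : 'S_n) (T : raw n) : R :=
  YoungForm.ext (fun a : 'I_(dim_part la) => \sum_b young_rep R la s a b) T.

Lemma rowsum_tab n (la : intpart n) s (a : 'I_(dim_part la)) :
  rowsum la s (tab a) = act s (fun=> 1) a.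
Proof. by rewrite /rowsum YoungForm.ext_tab; apply: eq_bigr => b _; rewrite mulr1. Qed.

Lemma rowsum_restrict n (la : intpart n.+1) (mu : intpart n) s (T : syt la) (X : syt mu) :
  restrict T = X -> rowsum la (lift_max_perm s) T = rowsum mu s X.
Proof.
have [a <-] := YoungForm.tab_surj T; have [c <-] := YoungForm.tab_surj X => e.
by rewrite !rowsum_tab -(act_restrict s (fun=> 1) e).
Qed.

(** This is the dimension of [la] times the difference between the total sum and [m]. *)
Definition deviation (m : R) n (la : intpart n) (s : 'S_n) : R :=
  \sum_(T : syt la) (rowsum la s T - m).

Lemma deviation_row (m : R) n (la : intpart n.+1) (s : 'S_n) (i : 'I_n.+1) :
  \sum_(T : syt la | (T ord_max).1 == i) (rowsum la (lift_max_perm s) T - m) =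
  \sum_(mu | covr i mu la) deviation m mu s.
Proof.
rewrite (sum_syt_row (fun T => rowsum la (lift_max_perm s) T - m)).
apply: eq_bigr => mu hmu; apply: eq_bigr => X _; congr (_ - _).
by apply: (@rowsum_restrict _ _ _ s (Syt (extend_syt X hmu)) X); rewrite /= extendK.
Qed.

Lemma deviation_raise (m : R) n (la : intpart n.+1) (s : 'S_n) :
  deviation m la (lift_max_perm s) = \sum_(mu | cov mu la) deviation m mu s.
Proof.
rewrite big_cov_down /deviation (partition_big (fun T : syt la => (T ord_max).1) predT) //=.
by apply: eq_bigr => i _; rewrite deviation_row.
Qed.

End Action.

(** * Bounding the partial sum *)

Section Bound.
Variable R : rcfType.

(** The sum counts the positive integers up to [y], that is, it is the integer part of [y]. *)
Lemma count_le_dist (y : R) N : 0 <= y -> y <= N%:R ->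
  `|\sum_(b < N) (b.+1%:R <= y)%R%:R - y| <= 1.
Proof.
move=> y0 yN.
have full K : K%:R <= y -> \sum_(b < K) (b.+1%:R <= y)%R%:R = K%:R :> R.
  move=> Ky; rewrite (eq_bigr (fun=> 1)) ?sumr_const ?card_ord // => b _.
  by rewrite (le_trans _ Ky) // ler_nat.
have H K : \sum_(b < K) (b.+1%:R <= y)%R%:R <= y /\
    (y <= K%:R -> y - 1 <= \sum_(b < K) (b.+1%:R <= y)%R%:R :> R).
  elim: K => [|K [IH1 IH2]]; first by rewrite big_ord0; split => // ?; lra.
  have := full K.+1; rewrite big_ord_recr /= -natr1.
  have := full K; set S := \sum_(b < K) _ in IH1 IH2 * => f1 f2.
  case: (leP (K%:R + 1) y) f2 => h /= f2; first by move: (f2 isT) => ->; split => // ?; lra.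
  rewrite addr0; split => // _; case: (leP y K%:R) => [/IH2 //|/ltW/f1 ->]; lra.
have [h1 h2] := H N; have := h2 yN; rewrite ler_norml; lra.
Qed.

Lemma young_rep_last n (la : intpart n.+1) (g : 'I_n.+1 * 'I_n.+1 -> R) (s : 'S_n)
    (v : 'I_(dim_part la) -> R) a :
  \sum_b young_rep R la (lift_max_perm s) a b * (g (tab b ord_max) * v b) =
  g (tab a ord_max) * \sum_b young_rep R la (lift_max_perm s) a b * v b.
Proof.
have := act_last_box g s (YoungForm.ext v) a; rewrite /act.
under eq_bigr do rewrite YoungForm.ext_tab.
by under [X in _ = _ * X]eq_bigr do rewrite YoungForm.ext_tab.
Qed.

(* The tableaux whose last letter lies strictly below row [i] contribute whole
   blocks, and those in row [i] the last, incomplete block. *)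
Lemma initial_segment_split n (la : intpart n.+1) (x : pred 'I_(dim_part la)) :
  (0 < dim_part la)%N -> (forall a b : 'I_(dim_part la), (a <= b)%N -> x b -> x a) ->
  exists a0 : 'I_(dim_part la), let i := (tab a0 ord_max).1 in
    forall a, x a = (i < (tab a ord_max).1)%N || x a && ((tab a ord_max).1 == i).
Proof.
move=> d0 xmono; have [/existsP[b0 xb0]|nx] := boolP [exists b, x b].
  have [b xb bmax] := @arg_maxnP _ b0 x (fun b => b : nat) xb0; exists b => i a.
  have [xa|nxa] := boolP (x a) => /=.
    have := tab_last_row (bmax _ xa); rewrite leq_eqVlt => /predU1P[/val_inj|] e.
      by rewrite /i e eqxx orbT.
    by rewrite e.
  rewrite orbF; apply/esym/negbTE; rewrite -leqNgt; apply: tab_last_row.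
  by rewrite leqNgt; apply: contra nxa => /ltnW ab; apply: xmono xb.
move: nx; rewrite negb_exists => /forallP nx; exists (Ordinal d0) => i a.
rewrite (negbTE (nx a)) orbF; apply/esym/negbTE; rewrite -leqNgt.
exact: tab_last_row.
Qed.

(** The shape [mu] is the one whose tableaux form the incomplete block. Complete blocks contribute
    their deviations; everything else is of the order of that block. *)
Lemma partial_sum_bound n (la : intpart n.+1) (s : 'S_n) (u m : R) :
  0 <= u <= 1 -> (0 < dim_part la)%N ->
  exists2 mu, cov mu la &
    `|partial_sum la u (lift_max_perm s) - u * m| * (dim_part la)%:R <=
    \sum_(nu | cov nu la) `|deviation m nu s| + (1 + 2%:R * `|m|) * (dim_part mu)%:R.
Proof.
move=> /andP[u0 u1] d0; set d : R := (dim_part la)%:R.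
have dp : 0 < d by rewrite ltr0n.
pose x (b : 'I_(dim_part la)) := b.+1%:R <= u * d.
have xmono (a b : 'I_(dim_part la)) : (a <= b)%N -> x b -> x a.
  by move=> ab; apply: le_trans; rewrite ler_nat.
have [a0 xE] := initial_segment_split d0 xmono.
set i := (tab a0 ord_max).1 in xE; rewrite /= in xE.
have [mu [hmu _ _]] := syt_last (tab a0).
exists mu; first by apply/existsP; exists i.
pose rho := young_rep R la (lift_max_perm s).
pose row (a : 'I_(dim_part la)) := (tab a ord_max).1.
(* Indicators of the complete blocks and of the selected part of the incomplete block. *)
pose chi a : R := (i < row a)%N%:R; pose dl a : R := (x a && (row a == i))%:R.
have xR a : (x a)%:R = chi a + dl a.
  rewrite xE /chi /dl -/(row a); case: ltngtP => [lt|lt|/val_inj e] /=.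
  - by rewrite -val_eqE gtn_eqF // andbF addr0.
  - by rewrite add0r.
  - by rewrite add0r.
have N1 : \sum_(a | row a == i) 1 = (dim_part mu)%:R :> R.
  rewrite (big_tab (fun=> 1) (fun T : syt la => (T ord_max).1 == i)).
  rewrite (sum_syt_restrict_row (fun=> 1)) (big_pred1 mu) ?sumr_const // => nu.
  by apply/idP/eqP => [/covr_down/(_ hmu)|->].
have mu1 : 1 <= (dim_part mu)%:R :> R.
  by rewrite -N1 (bigD1 a0) ?/row //= lerDl sumr_ge0.
have dlN : \sum_a dl a <= (dim_part mu)%:R.
  rewrite -N1 [leRHS]big_mkcond; apply: ler_sum => a _; rewrite /dl.
  by case: (_ == _); rewrite ?andbF ?andbT //; case: (x a).
have PSE : partial_sum la u (lift_max_perm s) * d =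
    \sum_a (x a)%:R * \sum_b rho a b * (x b)%:R.
  rewrite /partial_sum mulr_suml big_mkcond; apply: eq_bigr => a _.
  rewrite -/(x a); case: (x a); last by rewrite mul0r.
  rewrite mul1r mulr_suml big_mkcond; apply: eq_bigr => b _.
  rewrite -/(x b); case: (x b); last by rewrite mulr0.
  by rewrite mulr1 divfK ?gt_eqF.
(* Functions of the last box commute with [rho]. In a complete block, the truncated row sum is
   therefore the full row sum. *)
have rhox a : \sum_b rho a b * (x b)%:R =
    chi a * (\sum_b rho a b) + (row a == i)%:R * \sum_b rho a b * dl b.
  transitivity (\sum_b rho a b * (chi b * 1) + \sum_b rho a b * ((row b == i)%:R * dl b)).
    rewrite -big_split; apply: eq_bigr => b _ /=; rewrite xR mulr1 mulrDr; congr (_ + _ * _).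
    by rewrite /dl; case: (row b == i); rewrite ?andbF ?mul0r ?mul1r.
  rewrite (young_rep_last (fun y => (i < y.1)%N%:R)) (young_rep_last (fun y => (y.1 == i)%:R)).
  by congr (_ * _ + _); apply: eq_bigr => b _; rewrite mulr1.
have PSE2 : partial_sum la u (lift_max_perm s) * d =
    \sum_a chi a * (\sum_b rho a b) + \sum_a dl a * \sum_b rho a b * dl b.
  rewrite PSE -big_split; apply: eq_bigr => a _ /=; rewrite rhox xR.
  have c2 : chi a * chi a = chi a by rewrite /chi; case: (_ < _)%N; rewrite ?mulr1 ?mulr0.
  have cd : chi a * (row a == i)%:R = 0.
    rewrite /chi; case: eqP => [->|_]; last by rewrite mulr0.
    by rewrite ltnn mul0r.
  have dd : dl a * (row a == i)%:R = dl a.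
    by rewrite /dl; case: (_ == _); rewrite ?andbF ?mulr1 ?mul0r.
  have dc : dl a * chi a = 0.
    by rewrite -dd -mulrA [_ * chi a]mulrC cd mulr0.
  by rewrite mulrDl !mulrDr !mulrA c2 cd dc dd !mul0r addr0 add0r.
(* The last bracket compares the number of selected tableaux with [u * d]. In the constant
   [1 + 2|m|], the 1 comes from the quadratic form in [dl], one [|m|] from this rounding error and
   one from the sum of [dl]. *)
have TE : (partial_sum la u (lift_max_perm s) - u * m) * d =
    \sum_a chi a * (\sum_b rho a b - m) + \sum_a dl a * (\sum_b rho a b * dl b)
    + (m * (\sum_a (x a)%:R - u * d) - m * \sum_a dl a).
  rewrite mulrBl PSE2.
  have -> : \sum_a chi a * (\sum_b rho a b - m) =
      \sum_a chi a * (\sum_b rho a b) - m * \sum_a chi a.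
    by rewrite mulr_sumr -sumrB; apply: eq_bigr => a _; rewrite mulrBr [m * _]mulrC.
  have -> : \sum_a (x a)%:R = \sum_a chi a + \sum_a dl a.
    by rewrite -big_split; apply: eq_bigr.
  ring.
have t1 : `|\sum_a chi a * (\sum_b rho a b - m)| <= \sum_(nu | cov nu la) `|deviation m nu s|.
  rewrite (_ : \sum_a _ = \sum_(i' < n.+1 | (i < i')%N) \sum_(nu | covr i' nu la) deviation m nu s).
    rewrite big_cov_down; apply: le_trans (ler_norm_sum _ _ _) _.
    rewrite big_mkcond; apply: ler_sum => i' _; case: ifP => _; first exact: ler_norm_sum.
    exact: sumr_ge0.
  under [RHS]eq_bigr do rewrite -deviation_row.
  rewrite [LHS](partition_big row predT) //= [RHS]big_mkcond; apply: eq_bigr => i' _.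
  case: ifP => lt.
    rewrite -(big_tab (fun T : syt la => rowsum R la (lift_max_perm s) T - m)
      (fun T : syt la => (T ord_max).1 == i')).
    apply: eq_bigr => a /eqP e; rewrite /chi e lt mul1r rowsum_tab; congr (_ - _).
    by apply: eq_bigr => b _; rewrite mulr1.
  by rewrite big1 // => a /eqP e; rewrite /chi e lt mul0r.
have t2 : `|\sum_a dl a * (\sum_b rho a b * dl b)| <= (dim_part mu)%:R.
  apply: le_trans (young_rep_quad_bound _ _) _; apply: le_trans dlN.
  by apply: ler_sum => a _; rewrite /dl; case: (_ && _); rewrite ?expr1n ?expr0n.
have t3 : `|\sum_a (x a)%:R - u * d| <= 1.
  by apply: count_le_dist; [exact: mulr_ge0 u0 (ltW dp) | exact: ler_piMl (ltW dp) u1].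
have t4 : 0 <= \sum_a dl a by apply: sumr_ge0 => a _; rewrite ler0n.
rewrite -[d in leLHS]gtr0_norm // -normrM TE.
apply: le_trans (ler_normD _ _) _; rewrite mulrDl mul1r addrA.
apply: lerD; first by apply: le_trans (ler_normD _ _) _; apply: lerD.
apply: le_trans (ler_normB _ _) _; rewrite !normrM -mulrDr -mulrA mulrCA ler_wpM2l //.
by rewrite [X in _ + X]ger0_norm //; lra.
Qed.


(** A weighted inequality of arithmetic and geometric means, trading absolute values for squares,
    whose Plancherel averages are computable. *)
Lemma abs_le_sq (x y : R) (t : R) : 0 < t -> 0 < y -> `|x| <= t * y + x ^+ 2 / y / t.
Proof.
move=> t0 y0; rewrite -(ler_pM2r (mulr_gt0 t0 y0)) mulrDl.
have -> : x ^+ 2 / y / t * (t * y) = x ^+ 2 by field; rewrite !gt_eqF.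
rewrite -[x ^+ 2]real_normK ?num_real //.
have := sqr_ge0 (`|x| - t * y); have := sqr_ge0 (t * y); have := normr_ge0 x.
by move: (`|x|) => z; nra.
Qed.

(** The linear terms of the deviations add up to [t * dim la] by the branching rule; the incomplete
    block gives another [t * dim la]. Its unknown shape is absorbed by summing over all covered
    shapes. *)
Lemma partial_sum_quad_bound n (la : intpart n.+1) (s : 'S_n) (u m t : R) :
  0 <= u <= 1 -> (0 < dim_part la)%N -> 0 < t ->
  `|partial_sum la u (lift_max_perm s) - u * m| <= 2%:R * t +
  (\sum_(mu | cov mu la) deviation m mu s ^+ 2 / (dim_part mu)%:R / (dim_part la)%:R +
   (1 + 2%:R * `|m|) ^+ 2 *
     \sum_(mu | cov mu la) (dim_part mu)%:R ^+ 2 / (dim_part la)%:R ^+ 2) / t.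
Proof.
move=> hu d0 t0; set c := 1 + 2%:R * `|m|; set d : R := (dim_part la)%:R.
have dp : 0 < d by rewrite ltr0n.
have [mu hmu] := partial_sum_bound s m hu d0; rewrite -/c -/d => h.
rewrite -(ler_pM2r dp); apply: le_trans h _.
have dev nu : `|deviation m nu s| <=
    t * (dim_part nu)%:R + deviation m nu s ^+ 2 / (dim_part nu)%:R / t.
  have [d_nu|] := posnP (dim_part nu); last by move=> h; apply: abs_le_sq; rewrite ?ltr0n.
  rewrite /deviation big1 ?normr0 ?expr0n ?mul0r ?addr0 ?mulr_ge0 ?(ltW t0) // => T.
  by have := card0_eq d_nu T; rewrite inE.
have h1 : \sum_(nu | cov nu la) `|deviation m nu s| <=
    t * d + (\sum_(nu | cov nu la) deviation m nu s ^+ 2 / (dim_part nu)%:R) / t.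
  rewrite /d dim_restrict mulr_sumr mulr_suml -big_split.
  by apply: ler_sum => nu _; apply: dev.
have h2 := abs_le_sq (c * (dim_part mu)%:R) t0 dp.
have h3 : (dim_part mu)%:R ^+ 2 <= \sum_(nu | cov nu la) (dim_part nu)%:R ^+ 2 :> R.
  by rewrite (bigD1 mu) //= lerDl sumr_ge0 // => nu _; rewrite sqr_ge0.
have h4 : c * (dim_part mu)%:R <= t * d +
    c ^+ 2 * (\sum_(nu | cov nu la) (dim_part nu)%:R ^+ 2) / d / t.
  apply: le_trans (ler_norm _) (le_trans h2 _); rewrite lerD2l.
  rewrite exprMn ler_pM2r ?invr_gt0 // ler_pM2r ?invr_gt0 //.
  by rewrite ler_wpM2l ?sqr_ge0.
apply: le_trans (lerD h1 h4) _; rewrite -!mulr_suml.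
move: (\sum_(_ | _) _) (\sum_(_ | _) _) => A B.
rewrite le_eqVlt; apply/orP; left; apply/eqP; field.
by rewrite !gt_eqF.
Qed.

(** A Chebyshev inequality: on the event, the Plancherel weight is at most [Q la], and [Q] is
    nonnegative and summed over all shapes. *)
Lemma plancherel_prob_bound n (s : 'S_n) (u m e B : R) :
  0 <= u <= 1 -> 0 < e -> (forall mu : intpart n, (corners mu).+1%:R <= B) ->
  plancherel_prob R (fun la : intpart n.+1 =>
    e < `|partial_sum la u (lift_max_perm s) - u * m|) <=
  8%:R / e ^+ 2 *
    ((\sum_mu deviation m mu s ^+ 2) / n`!%:R + (1 + 2%:R * `|m|) ^+ 2 * B / n.+1%:R).
Proof.
move=> hu e0 hB; set c := 1 + 2%:R * `|m|; set K := 8%:R / e ^+ 2.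
have K0 : 0 <= K by rewrite divr_ge0 ?sqr_ge0.
have nS : n.+1%:R != 0 :> R by rewrite pnatr_eq0.
have f0 k : 0 < k`!%:R :> R by rewrite ltr0n fact_gt0.
pose Q (la : intpart n.+1) : R := K *
      (\sum_(mu | cov mu la) (dim_part la)%:R * (deviation m mu s ^+ 2 / (dim_part mu)%:R) +
       c ^+ 2 * \sum_(mu | cov mu la) (dim_part mu)%:R ^+ 2) / n.+1`!%:R.
have Q0 la : 0 <= Q la.
  apply: divr_ge0 => //; apply: mulr_ge0 => //; apply: addr_ge0.
    by apply: sumr_ge0 => mu _; apply: mulr_ge0 => //; apply: divr_ge0; rewrite ?sqr_ge0.
  by apply: mulr_ge0; rewrite ?sqr_ge0 ?sumr_ge0 // => mu _; rewrite sqr_ge0.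
have pt (la : intpart n.+1) : e < `|partial_sum la u (lift_max_perm s) - u * m| ->
    plancherel R la <= Q la.
  rewrite /plancherel; have [d0|d0] := posnP (dim_part la); first by rewrite d0 expr0n mul0r.
  move=> he; rewrite /Q ler_pM2r ?invr_gt0 //.
  (* With [t = e / 4] the term [2 t] uses half of [e]; the product [(e - 2 t) * t] equals
     [e ^ 2 / 8], whence the constant 8. *)
  have t0 : 0 < e / 4%:R by rewrite divr_gt0.
  have := partial_sum_quad_bound s m hu d0 t0; rewrite -/c /= => h.
  have := lt_le_trans he h; rewrite -!mulr_suml -!mulr_sumr.
  have dp : 0 < (dim_part la)%:R :> R by rewrite ltr0n.
  move: (\sum_(_ | _) _) (\sum_(_ | _) _) ((dim_part la)%:R : R) dp => C A d dp h'.
  have d2 : 0 < d ^+ 2 by rewrite exprn_gt0.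
  have e2 : 0 < e ^+ 2 by rewrite exprn_gt0.
  rewrite -(ler_pM2r e2) /K.
  have -> : 8%:R / e ^+ 2 * (d * A + c ^+ 2 * C) * e ^+ 2 = 8%:R * (d * A + c ^+ 2 * C).
    by field; rewrite gt_eqF.
  have : (e - 2%:R * (e / 4%:R)) * (e / 4%:R) * d ^+ 2 <=
      (A / d + c ^+ 2 * (C / d ^+ 2)) / (e / 4%:R) * (e / 4%:R) * d ^+ 2.
    by rewrite ler_pM2r // ler_pM2r // lerBlDl ltW.
  have -> : (A / d + c ^+ 2 * (C / d ^+ 2)) / (e / 4%:R) * (e / 4%:R) * d ^+ 2 =
     d * A + c ^+ 2 * C by field; rewrite !gt_eqF.
  have -> : (e - 2%:R * (e / 4%:R)) * (e / 4%:R) * d ^+ 2 = d ^+ 2 * e ^+ 2 / 8%:R by field.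
  by rewrite ler_pdivrMr // [X in _ <= X -> _]mulrC.
rewrite /plancherel_prob big_mkcond.
apply: le_trans (_ : \sum_la Q la <= _).
  by apply: ler_sum => la _; case: ifP => [|_]; [exact: pt | exact: Q0].
rewrite -mulr_suml -mulr_sumr -mulrA ler_wpM2l // big_split /= -mulr_sumr mulrDl.
(* After exchanging sums, the dimensions of the covers of [mu] add up to [n.+1] times that of [mu],
   cancelling the denominator. In the second term each [mu] has at most [B] covers. *)
apply: lerD; rewrite (exchange_big_dep predT) //=.
  rewrite factS natrM invfM mulrA ler_wpM2r ?invr_ge0 // mulr_suml.
  apply: ler_sum => mu _; rewrite -mulr_suml -[\sum_(_ | _) _]/(lower (dimv R) mu) lower_dimv.
  have [->|nz] := eqVneq ((dim_part mu)%:R : R) 0.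
    by rewrite /dimv invr0 !mulr0 mul0r sqr_ge0.
  rewrite le_eqVlt; apply/orP; left; apply/eqP; rewrite /dimv.
  by move: (n.+1%:R : R) nS nz => N nS nz; field; rewrite nz nS.
have -> : c ^+ 2 * B / n.+1%:R = c ^+ 2 * (\sum_(mu : intpart n) (dim_part mu)%:R ^+ 2 * B) / n.+1`!%:R.
  rewrite -mulr_suml (_ : \sum_(mu : intpart n) _ = n`!%:R); last first.
    by rewrite -sum_dim2; apply: eq_bigr => mu _; rewrite -expr2.
  rewrite factS natrM; move: (n.+1%:R : R) nS (n`!%:R : R) (f0 n) => N nS f fpos.
  by field; rewrite nS gt_eqF.
rewrite ler_pM2r ?invr_gt0 // ler_wpM2l ?sqr_ge0 //.
apply: ler_sum => mu _; rewrite sumr_const card_cov_up -[leLHS]mulr_natr.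
by rewrite ler_wpM2l ?sqr_ge0.
Qed.
End Bound.

(** * Convergence *)

Section Extension.
Variables (r : nat) (sigma : 'S_r).

(** Extending [sigma] first as a function on [nat] yields its extensions to all sizes without casts
    between equal but differently written sizes. *)
Definition ext_fun (i : nat) : nat :=
  if (insub i : option 'I_r) is Some j then sigma j else i.

(* Only meaningful for [r <= n]. *)
Definition ext_perm n : 'S_n :=
  odflt 1%g [pick s : 'S_n | [forall i : 'I_n, s i == ext_fun i :> nat]].

Lemma ext_perm_unique n (s : 'S_n) : (forall i : 'I_n, s i = ext_fun i :> nat) ->
  ext_perm n = s.
Proof.
move=> h; rewrite /ext_perm; case: pickP => [t /forallP ht|/(_ s)/forallP[] i].
  by apply/permP => i; apply/val_inj; rewrite /= h; apply/eqP.
by rewrite h.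
Qed.

Lemma ext_perm_base : ext_perm r = sigma.
Proof. by apply: ext_perm_unique => i; rewrite /ext_fun valK. Qed.

Lemma ext_fun_out i : (r <= i)%N -> ext_fun i = i.
Proof. by move=> h; rewrite /ext_fun insubN // -leqNgt. Qed.

Lemma ext_perm_widen m : ext_perm (r + m) = widen_perm m sigma.
Proof.
apply: ext_perm_unique => i; rewrite permE /widen_perm_fun; case: splitP => j e.
  by rewrite /= e /ext_fun valK.
by rewrite /= -e ext_fun_out // e leq_addr.
Qed.

Lemma ext_permE n (i : 'I_n) : (r <= n)%N -> ext_perm n i = ext_fun i :> nat.
Proof.
move=> /subnKC e; rewrite -e in i *; rewrite ext_perm_widen permE /widen_perm_fun.
case: splitP => j ej; first by rewrite /= ej /ext_fun valK.
by rewrite /= -ej ext_fun_out // ej leq_addr.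
Qed.

Lemma ext_permS n : (r <= n)%N -> ext_perm n.+1 = lift_max_perm (ext_perm n).
Proof.
move=> rn; apply: ext_perm_unique => i; case: (unliftP ord_max i) => [j ->|->].
  by rewrite lift_perm_lift !lift_max ext_permE.
by rewrite lift_perm_id ext_fun_out.
Qed.

End Extension.

(** * Rate of convergence *)

Section Deviation.
Variables (R : rcfType) (r : nat) (sigma : 'S_r).

Let m_sigma : R := plancherel_expect (fun nu : intpart r => total_sum R nu sigma).

Definition dev_gvec : gvec R :=
  fun n la => deviation m_sigma la (ext_perm sigma n).

Lemma dev_gvec_raise n (la : intpart n.+1) : (r <= n)%N ->
  dev_gvec la = raise dev_gvec la.
Proof. by move=> rn; rewrite /dev_gvec ext_permS // deviation_raise. Qed.

(** The product of the deviations with dim is [r!] times the Plancherel mean of the total sum minus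
    [m_sigma], and [m_sigma] is that mean. *)
Lemma dev_gvec_orth : ip r dev_gvec (dimv R) = 0.
Proof.
have f0 : r`!%:R != 0 :> R by rewrite pnatr_eq0 -lt0n fact_gt0.
have E (la : intpart r) : dev_gvec la * dimv R la =
    r`!%:R * (plancherel R la * total_sum R la sigma) - m_sigma * (dimv R la * dimv R la).
  rewrite /dev_gvec ext_perm_base /deviation sumrB sumr_const mulrBl; congr (_ - _); last first.
    by rewrite -mulr_natr -mulrA.
  rewrite /plancherel /total_sum /dimv.
  rewrite -(big_tab (fun T : syt la => rowsum R la sigma T) predT).
  have -> : \sum_(a : 'I_(dim_part la) | predT (tab a)) rowsum R la sigma (tab a) =
      \sum_a \sum_b young_rep R la sigma a b.
     by apply: eq_big => // a _; rewrite rowsum_tab; apply: eq_bigr => b _; rewrite mulr1.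
  under [in RHS]eq_bigr do rewrite -mulr_suml; rewrite -mulr_suml.
  move: (\sum_a _) => S; have [e|nz] := eqVneq ((dim_part la)%:R : R) 0.
    by rewrite e expr0n !mul0r !mulr0.
  by field; rewrite f0 nz.
rewrite /ip (eq_bigr _ (fun la _ => E la)) sumrB -!mulr_sumr -[\sum_(i | _) plancherel _ _ * _]/m_sigma.
by rewrite -[\sum_(i | _) _]/(ip r (dimv R) (dimv R)) sum_dim2 mulrC subrr.
Qed.

(** The deviations contribute O(1/M) and the incomplete block O(1/sqrt n), from a number of covers
    of order sqrt n divided by n. *)
Lemma plancherel_prob_rate (u e : R) : 0 <= u <= 1 -> 0 < e ->
  exists2 K, 0 <= K & forall M,
    plancherel_prob R (fun la : intpart (M + r).+1 =>
      e < `|partial_sum la u (ext_perm sigma (M + r).+1) - u * m_sigma|) <=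
    K / Num.sqrt M.+1%:R.
Proof.
move=> hu e0; have [C C0 hC] := orbit_norm_bound dev_gvec_raise dev_gvec_orth.
set c := 1 + 2%:R * `|m_sigma|; exists (8%:R / e ^+ 2 * (C + c ^+ 2 * 3%:R)) => [|M].
  by rewrite !(mulr_ge0, addr_ge0) ?invr_ge0 ?sqr_ge0.
have rM : (r <= M + r)%N by rewrite leq_addl.
set n := (M + r)%N in rM *; have hCM := hC M; rewrite -/n in hCM.
have n0 : 0 < n.+1%:R :> R by rewrite ltr0n.
have M0 : 0 < M.+1%:R :> R by rewrite ltr0n.
(* Since [corners mu ^ 2 <= 2 * n], the square of [corners mu + 1] is at most [9 * n.+1]. *)
have hB (mu : intpart n) : (corners mu).+1%:R <= 3%:R * Num.sqrt n.+1%:R :> R.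
  rewrite -(ler_pXn2r (ltn0Sn 1)) ?nnegrE ?mulr_ge0 ?sqrtr_ge0 //.
  rewrite exprMn sqr_sqrtr ?ler0n // -!natrX -natrM ler_nat.
  by have := corners_le mu; nia.
rewrite (ext_permS sigma rM).
apply: le_trans (plancherel_prob_bound _ _ hu e0 hB) _; rewrite -/c -[leRHS]mulrA.
apply: ler_wpM2l; first by rewrite mulr_ge0 ?invr_ge0 ?sqr_ge0.
have sM0 : 0 < Num.sqrt M.+1%:R :> R by rewrite sqrtr_gt0.
have sn0 : 0 < Num.sqrt n.+1%:R :> R by rewrite sqrtr_gt0.
have f0 : 0 < n`!%:R :> R by rewrite ltr0n fact_gt0.
rewrite [leRHS]mulrDl; apply: lerD.
  have -> : \sum_mu deviation m_sigma mu (ext_perm sigma n) ^+ 2 = ip n dev_gvec dev_gvec.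
    by apply: eq_bigr => mu _; rewrite expr2.
  rewrite ler_pdivrMr //; apply: le_trans (_ : C * n`!%:R / M.+1%:R <= _).
    by rewrite ler_pdivlMr.
  rewrite [leRHS]mulrAC ler_wpM2l ?mulr_ge0 ?(ltW f0) // lef_pV2 ?posrE //.
  have s1 : 1 <= Num.sqrt M.+1%:R :> R by rewrite -[leLHS]sqrtr1 ler_sqrt ?ler1n // ltr0n.
  by rewrite -[leRHS]sqr_sqrtr ?(ltW M0) // expr2 ler_peMl ?(ltW sM0).
move: (c ^+ 2) (sqr_ge0 c) => c2 c20; rewrite -!mulrA ler_wpM2l // ler_wpM2l //.
have -> : Num.sqrt n.+1%:R / n.+1%:R = (Num.sqrt n.+1%:R)^-1 :> R.
  by rewrite -{2}[n.+1%:R]sqr_sqrtr ?(ltW n0) // expr2 invfM mulrA divff ?mul1r // gt_eqF.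
by rewrite lef_pV2 ?posrE // ler_sqrt ?ltr0n ?ler0n // ler_nat ltnS leq_addr.
Qed.

End Deviation.

Local Open Scope classical_set_scope.

Theorem theorem1p3 (R : realType) (u : R) (hu : 0 <= u <= 1)
    (r : nat) (sigma : 'S_r) (eps : R) (heps : 0 < eps) :
  let m_sigma : R :=
    plancherel_expect (fun nu : intpart r => total_sum R nu sigma) in
  plancherel_prob R (fun la : intpart (r + m) =>
    eps < `|partial_sum la u (widen_perm m sigma) - u * m_sigma|)
    @[m --> \oo] --> (0 : R).
Proof.
move=> m_sigma; have [K K0 hK] := plancherel_prob_rate sigma hu heps.
apply/cvgr0Pnorm_lt => e e0; near=> m.
have m0 : (0 < m)%N by near: m; exists 1%N.
(* This threshold is equivalent to [K / sqrt m < e]. *)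
have mK : K ^+ 2 / e ^+ 2 < m%:R by near: m; apply: nbhs_infty_gtr.
rewrite ger0_norm; last first.
  by apply: sumr_ge0 => la _; rewrite divr_ge0 ?sqr_ge0.
rewrite -ext_perm_widen.
(* The rate is stated at sizes [(M + r).+1], so one of the [m] fixed letters is split off. *)
have -> : (r + m)%N = (m.-1 + r).+1 by rewrite addnC -addSn prednK.
apply: le_lt_trans (hK m.-1) _; rewrite prednK //.
have sm0 : 0 < Num.sqrt m%:R :> R by rewrite sqrtr_gt0 ltr0n.
rewrite ltr_pdivrMr // -(ltr_pXn2r (ltn0Sn 1)) ?nnegrE ?mulr_ge0 ?(ltW e0) ?(ltW sm0) //.
by rewrite exprMn sqr_sqrtr // mulrC -ltr_pdivrMr ?exprn_gt0.
Unshelve. all: by end_near.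
Qed.
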